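(* Let $G=(V,E)$ be a node-weighted $n$-node graph of maximum degree $\Delta$ and neighborhood independence $\beta$, with node weights $w:V\to\mathbb{N}$ and maximum weight $W$. Let $\mathsf{OPT}$ be the weight of a maximum weight independent set of $G$, and assume that $G$ is equipped with a proper $\xi$-vertex coloring. Then, for every $\varepsilon>0$, there are deterministic $\mathsf{CONGEST}$ algorithms on $G$ that compute independent sets (1) of weight at least $\frac{1-\varepsilon}{\beta}\cdot\mathsf{OPT}$ in $O\big(\log^2(\Delta W)\cdot\log(1/\varepsilon)+\log^*\xi\big)$ rounds; (2) of weight at least $(1-\varepsilon)\cdot\frac{w(V)}{\Delta+1}$ in $O\big(\log^2\Delta\cdot\log(1/\varepsilon)+\log^*\xi\big)$ rounds; (3) of weight at least $\left(\frac12-\varepsilon\right)\cdot\sum_{v\in V}\frac{(w(v))^2}{w(v)+w(N(v))}$ in $O\big(\frac{\log^2(\Delta/\varepsilon)}{\varepsilon}+\log^*\xi\big)$ rounds.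
   Context: The $\mathsf{CONGEST}$ model: the network is the graph $G$; nodes have unique $O(\log n)$-bit identifiers; computation proceeds in synchronous rounds, in each of which every node may send an $O(\log n)$-bit message to each neighbor; at the end each node knows its own output (here: whether it is in the independent set). Nodes know the weights of their neighbors (equivalently, weights fit in $O(\log n)$ bits). For $S\subseteq V$, $w(S)=\sum_{v\in S}w(v)$; $N(v)$ is the set of neighbors of $v$. The neighborhood independence $\beta$ of $G$ is the maximum, over all nodes $v$, of the size of a largest independent set in the subgraph induced by $N(v)$. A proper $\xi$-vertex coloring assigns each node one of $\xi$ colors so that adjacent nodes get different colors; each node knows its color. *)

(* Defs.v *)
From mathcomp Require Import all_boot all_order all_algebra.
From mathcomp Require Import reals exp.

Set Implicit Arguments.
Unset Strict Implicit.
Unset Printing Implicit Defensive.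

Import Order.TTheory GRing.Theory Num.Theory.

Record graph := Graph {
  vertex :> finType;
  adj : rel vertex;
  adj_sym : symmetric adj;
  adj_irrefl : irreflexive adj }.

Definition nbrs (G : graph) (v : G) : {set G} := [set u | adj v u].

Definition max_degree (G : graph) : nat := \max_(v : G) #|nbrs v|.

Definition independent (G : graph) (S : {set G}) : bool :=
  [forall u in S, forall v in S, ~~ adj u v].

(* This is 0 iff G has no edge; the approximation factor 1 / beta is then read
   as 1, through maxn 1 (nbr_independence G). *)
Definition nbr_independence (G : graph) : nat :=
  \max_(v : G) \max_(S : {set G} | (S \subset nbrs v) && independent S) #|S|.

Definition wt (G : graph) (w : G -> nat) (S : {set G}) : nat :=
  \sum_(v in S) w v.

Definition max_weight (G : graph) (w : G -> nat) : nat := \max_(v : G) w v.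

Definition opt (G : graph) (w : G -> nat) : nat :=
  \max_(S : {set G} | independent S) wt w S.

(* An input to a CONGEST algorithm.  The ports of v list the neighbors of v in
   an arbitrary order; a node addresses its neighbors only through ports.
   Identifiers are distinct numbers below n ^ c, i.e. they have O(log n) bits. *)
Record network (c : nat) := Network {
  net_graph :> graph;
  weight : net_graph -> nat;
  ncolors : nat;
  color : net_graph -> 'I_ncolors;
  color_proper : forall u v, adj u v -> color u != color v;
  ident : net_graph -> 'I_(#|net_graph| ^ c);
  ident_inj : injective ident;
  ports : net_graph -> seq net_graph;
  ports_uniq : forall v, uniq (ports v);
  mem_ports : forall v u, (u \in ports v) = adj v u }.

(* Global knowledge, common to all nodes: n, and the parameters on which the
   round complexities depend (maximum degree, maximum weight and number of
   colors).  The neighborhood independence is not known to the nodes. *)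
Record global_input := GlobalInput {
  gl_n : nat;
  gl_degree : nat;
  gl_weight : nat;
  gl_colors : nat }.

Record local_input := LocalInput {
  in_ident : nat;
  in_color : nat;
  in_weight : nat;
  (* indexed by ports; its size is the degree of the node *)
  in_nbr_weights : seq nat }.

Definition message := seq bool.

(* A deterministic algorithm, executed by every node.  [send s i] is the message
   sent through port i, and [receive s ms] is the new state when [nth [::] ms i]
   arrives through port i.  A node terminates, irrevocably, as soon as [output]
   is [Some b], where b tells whether it joins the independent set. *)
Record algorithm := Algorithm {
  state : Type;
  init : global_input -> local_input -> state;
  send : state -> nat -> message;
  receive : state -> seq message -> state;
  output : state -> option bool }.

Definition net_global_input (c : nat) (N : network c) : global_input :=
  GlobalInput #|N| (max_degree N) (max_weight (@weight c N)) (ncolors N).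

Definition net_input (c : nat) (N : network c) (v : N) : local_input :=
  LocalInput (ident v) (color v) (weight v) [seq weight u | u <- ports v].

Definition terminated (A : algorithm) (s : state A) : bool := isSome (output s).

Definition sent (A : algorithm) (s : state A) (i : nat) : message :=
  if terminated s then [::] else send s i.

Definition round (A : algorithm) (c : nat) (N : network c)
    (st : N -> state A) : N -> state A := fun v =>
  if terminated (st v) then st v
  else receive (st v) [seq sent (st u) (index v (ports u)) | u <- ports v].

Definition run (A : algorithm) (c : nat) (N : network c) (t : nat) :
    N -> state A :=
  iter t (@round A c N) (fun v => init A (net_global_input N) (net_input v)).

(* Every message has at most K * ceil (log_2 n) bits. *)
Definition congest (A : algorithm) (c : nat) (N : network c) (K : nat) : Prop :=
  forall (t : nat) (v : N) (i : nat), i < size (ports v) ->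
  size (sent (run A t v) i) <= K * up_log 2 #|N|.

(* After t rounds all nodes have terminated, and their outputs describe I. *)
Definition computes (A : algorithm) (c : nat) (N : network c) (t : nat)
    (I : {set N}) : Prop :=
  forall v : N, output (run A t v) = Some (v \in I).

(* Rounding the logarithms up does not change the number of iterations needed to
   get down to 1, since x <= 2 ^ m iff up_log 2 x <= m for every natural m.
   As up_log 2 x < x for 1 < x, the fuel x suffices. *)
Fixpoint log_star_rec (fuel x : nat) : nat :=
  if fuel is f.+1 then
    if x <= 1 then 0 else (log_star_rec f (up_log 2 x)).+1
  else 0.

Definition log_star (x : nat) : nat := log_star_rec x x.

Local Open Scope ring_scope.

Definition log2 (R : realType) (x : R) : R := ln x / ln 2.

(* The factor log (1 / eps) in round complexities; the cut-off at 1 only matters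
   when 1 / 2 < eps, where log_2 (1 / eps) is below 1 or even negative. *)
Definition log_inv (R : realType) (eps : R) : R := Num.max 1 (log2 eps^-1).

(* Main.v *)
(* All three independent sets are obtained by rounding a fractional one.  The
   energy  sum_v w(v) x(v) - sum_{uv in E} min(w(u), w(v)) x(u) x(v)  of x is, for
   integral x, a lower bound on the weight that is left when every conflict is
   decided against the lighter endpoint.  The values x(v) are multiples of 2^-k,
   and they are rounded one bit at a time: every node with an odd numerator moves
   up or down, following the sign of the derivative of the energy, one class of a
   defective coloring after the other.  Simultaneous moves inside a class lose a
   small fraction of the quadratic term; this is absorbed by giving that term a
   weight 1 + e at the beginning and letting e decrease to 0 over the k scales.

   A defective coloring with O(J) classes and defect 1/J is computed in O(J)
   rounds from a coloring with 2^O(J) colors: colors are read as polynomials over a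
   field of size 2^a, a first step moves each node to its best evaluation point
   (one such step with unit weights and no conflicts is a step of Linial's
   algorithm), then every node walks along the values of its new polynomial and
   stops as soon as it meets little weight.  The initial coloring with poly(Delta)
   colors costs log* rounds.

   For part (3), x(v) = w(v) / (w(v) + w(N(v))) and e = eps.  For parts (1) and (2),
   rounding (with e = 1) a greedily built x, respectively the constant 1 / O(Delta),
   gives a constant fraction of OPT / beta, respectively w(V) / (Delta + 1), and
   O(log(1/eps)) repetitions inside a local-ratio scheme raise the constant to
   1 - eps. *)
Require Import Defs.
From mathcomp Require Import all_boot all_order all_algebra all_field.
From mathcomp Require Import reals exp.
From mathcomp Require Import zify ring lra.
From Stdlib Require Import FunctionalExtensionality.

Set Implicit Arguments.
Unset Strict Implicit.
Unset Printing Implicit Defensive.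

Import Order.TTheory GRing.Theory Num.Theory.

(** * Node programs *)

(** In each round a program broadcasts one and the same message through all ports. *)
Inductive prog (A : Type) : Type :=
| Ret (a : A)
| Comm (m : message) (f : seq message -> prog A).

Fixpoint bind (A B : Type) (p : prog A) (g : A -> prog B) : prog B :=
  match p with
  | Ret a => g a
  | Comm m f => Comm m (fun ms => bind (f ms) g)
  end.

Fixpoint loop (A : Type) (n : nat) (body : nat -> A -> prog A) (x : A) :
    prog A :=
  if n is n'.+1 then bind (loop n' body x) (body n') else Ret x.

(** A pair in [S * seq S] is what a node knows: its own value and those of its neighbors, in port
    order. *)
Definition mapk (S T : Type) (f : S -> T) (x : S * seq S) : T * seq T :=
  (f x.1, map f x.2).

Definition pairk (S T : Type) (x : S * seq S) (y : T * seq T) :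
    (S * T) * seq (S * T) :=
  ((x.1, y.1), zip x.2 y.2).

(** The message may depend on all that the sender knows, but the new value only on the old value and
    the message. So each neighbor recomputes it, and all copies stay in agreement. *)
Definition step (S T : Type) (g : S * seq S -> message)
    (h : S -> message -> T) (x : S * seq S) : prog (T * seq T) :=
  Comm (g x) (fun ms => Ret (mapk (fun y => h y.1 y.2) (pairk x (g x, ms)))).

Definition run_prog (p : global_input -> local_input -> prog bool) :
    algorithm :=
  {| state := prog bool;
     init := p;
     send := fun s _ => if s is Comm m _ then m else [::];
     receive := fun s ms => if s is Comm _ f then f ms else s;
     output := fun s => if s is Ret b then Some b else None |}.

Section Exec.
Variables (c : nat) (N : network c) (B : nat).

(* All nodes run in lockstep and stop after exactly r rounds with results a;
   every message has at most B bits. *)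
Inductive exec (A : Type) : (N -> prog A) -> nat -> (N -> A) -> Prop :=
| exec_ret P a : (forall v, P v = Ret (a v)) -> exec P 0 a
| exec_comm P m f r a :
    (forall v, P v = Comm (m v) (f v)) -> (forall v, size (m v) <= B) ->
    exec (fun v => f v [seq m u | u <- ports v]) r a -> exec P r.+1 a.

Definition view (T : Type) (X : N -> T) (v : N) : T * seq T :=
  (X v, [seq X u | u <- ports v]).

Lemma exec_retE (A : Type) (a : N -> A) : exec (fun v => Ret (a v)) 0 a.
Proof. exact: exec_ret. Qed.

Lemma exec_bind (A A' : Type) (P : N -> prog A) r a (Q : N -> A -> prog A') r' b :
  exec P r a -> exec (fun v => Q v (a v)) r' b ->
  exec (fun v => bind (P v) (Q v)) (r + r') b.
Proof.
elim=> {P r a} [P a PE|P m f r a PE mB _ IH] Qb.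
  suff -> : (fun v => bind (P v) (Q v)) = (fun v => Q v (a v)) by [].
  by apply: functional_extensionality => v; rewrite PE.
rewrite addSn.
apply: (@exec_comm _ _ m (fun v ms => bind (f v ms) (Q v))) => //.
- by move=> v; rewrite PE.
- exact: IH.
Qed.

Lemma exec_loop (A : Type) (body : N -> nat -> A -> prog A) (r n : nat)
    (Inv : nat -> (N -> A) -> Prop) (X : N -> A) :
  (forall i Y, i < n -> Inv i Y ->
     exists2 Z, exec (fun v => body v i (Y v)) r Z & Inv i.+1 Z) ->
  Inv 0 X ->
  exists2 Z, exec (fun v => loop n (body v) (X v)) (n * r) Z & Inv n Z.
Proof.
elim: n => [|n IH] step_ok X0; first by exists X => //; exact: exec_retE.
have [|Y eY IY] := IH _ X0; first by move=> i Y lt_in; apply: step_ok; lia.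
have [Z eZ IZ] := step_ok n Y (ltnSn n) IY.
by exists Z => //; rewrite mulSnr; exact: exec_bind eY eZ.
Qed.

Lemma mapk_view (S T : Type) (f : S -> T) (X : N -> S) v :
  mapk f (view X v) = view (fun u => f (X u)) v.
Proof. by rewrite /mapk /view -map_comp. Qed.

Lemma pairk_view (S T : Type) (X : N -> S) (Y : N -> T) v :
  pairk (view X v) (view Y v) = view (fun u => (X u, Y u)) v.
Proof. by rewrite /pairk /view zip_map. Qed.

Lemma exec_step (S T : Type) (g : N -> S * seq S -> message)
    (h : S -> message -> T) (X : N -> S) (Z : N -> T) :
  (forall v, size (g v (view X v)) <= B) ->
  (forall v, h (X v) (g v (view X v)) = Z v) ->
  exec (fun v => step (g v) h (view X v)) 1 (view Z).
Proof.
move=> gB ZE; pose m v := g v (view X v).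
apply: (@exec_comm _ _ m (fun v ms => Ret
  (mapk (fun y => h y.1 y.2) (pairk (view X v) (m v, ms))))) => //.
apply: exec_ret => v; rewrite -/(view m v) pairk_view mapk_view /view ZE.
by congr (Ret (_, _)); apply: eq_map => u; rewrite /= -ZE.
Qed.

Lemma big_view (T : Type) (R : Type) (idx : R) (op : Monoid.com_law idx)
    (F : T -> R) (X : N -> T) v :
  \big[op/idx]_(y <- (view X v).2) F y = \big[op/idx]_(u | adj v u) F (X u).
Proof.
rewrite big_map big_uniq ?ports_uniq //=.
by apply: eq_bigl => u; rewrite mem_ports.
Qed.

(** As all nodes stop in the same round, no running node meets a terminated neighbor. *)
Lemma exec_run (p : global_input -> local_input -> prog bool) r a :
  exec (fun v => p (net_global_input N) (net_input v)) r a ->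
  computes (run_prog p) r [set v | a v] /\
  forall t v i, size (sent (@run (run_prog p) c N t v) i) <= B.
Proof.
rewrite /computes /run /=; elim=> {r a} [P a PE|P m f r a PE mB _ [IHo IHs]].
  have fixP t : iter t (@round (run_prog p) c N) P = P.
    elim: t => //= t ->; apply: functional_extensionality => v.
    by rewrite /round /terminated /= PE.
  split=> [v|t v i]; first by rewrite /= PE inE.
  by rewrite fixP /sent /terminated /= PE.
have roundP : @round (run_prog p) c N P = fun v => f v [seq m u | u <- ports v].
  apply: functional_extensionality => v; rewrite /round /terminated /= PE /=.
  by congr (f v _); apply: eq_map => u; rewrite /sent /terminated /= PE.
split=> [v|t v i]; first by rewrite iterSr roundP; exact: IHo.
case: t => [|t]; last by rewrite iterSr roundP; exact: IHs.
rewrite /= /sent /terminated /= PE; exact: mB.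
Qed.

End Exec.

(** * Logarithms and message encodings *)

Lemma up_log_leE m n : (up_log 2 m <= n) = (m <= 2 ^ n).
Proof.
apply/idP/idP=> [le_n|]; last exact: up_log_min.
exact: leq_trans (up_logP m (isT : 1 < 2)) (leq_pexp2l _ le_n).
Qed.

Lemma up_logK m : m <= 2 ^ up_log 2 m.
Proof. by rewrite -up_log_leE. Qed.

Lemma up_log_leq m : up_log 2 m <= m.
Proof. by rewrite up_log_leE ltnW // ltn_expl. Qed.

Lemma up_log_mul m n : up_log 2 (m * n) <= up_log 2 m + up_log 2 n.
Proof. by rewrite up_log_leE expnD leq_mul ?up_logK. Qed.

Lemma up_log_add m n : up_log 2 (m + n) <= (up_log 2 m + up_log 2 n).+1.
Proof.
rewrite up_log_leE expnS mul2n -addnn leq_add //.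
  by apply: leq_trans (up_logK m) _; rewrite leq_pexp2l ?leq_addr.
by apply: leq_trans (up_logK n) _; rewrite leq_pexp2l ?leq_addl.
Qed.

Lemma ltn_up_log m : 1 < m -> up_log 2 m < m.
Proof.
case: m => [|[|m]] // _; rewrite ltnS up_log_leE.
by elim: m => // m IH; rewrite expnS; lia.
Qed.

Lemma iter_log_star x : iter (log_star x) (up_log 2) x <= 1.
Proof.
suff H f y : y <= f -> iter (log_star_rec f y) (up_log 2) y <= 1 by exact: H.
elim: f y => [|f IH] {}x /=; first by case: x.
case: (leqP x 1) => //= x1 xf.
by rewrite -iterS iterSr; apply: IH; have := ltn_up_log x1; lia.
Qed.

Fixpoint enc (r y : nat) : message :=
  if r is r'.+1 then odd y :: enc r' y./2 else [::].

Definition dec (s : message) : nat := foldr (fun (b : bool) a => b + a.*2) 0 s.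

Lemma size_enc r y : size (enc r y) = r.
Proof. by elim: r y => //= r IH y; rewrite IH. Qed.

Lemma encK r y : y < 2 ^ r -> dec (enc r y) = y.
Proof.
elim: r y => [|r IH] y /=; first by case: y.
by rewrite expnS => lty; rewrite IH ?odd_double_half //; lia.
Qed.

(* A Linial step takes a proper coloring with l-bit colors to one with
   [linial_bits D l]-bit colors, D being the maximum degree. *)
Definition linial_bits (D l : nat) : nat := (up_log 2 (D * l).+1).+1.*2.

Lemma linial_bits_leq D l :
  linial_bits D l <= (up_log 2 D).*2 + 6 + (up_log 2 l).*2.
Proof.
have := up_log_add (D * l) 1; have := up_log_mul D l.
by rewrite /linial_bits addn1 (_ : up_log 2 1 = 0) //; lia.
Qed.

(** The envelope 4 log D + 64 + 4 b reproduces itself with log b in place of b, since a logarithm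
    turns the factor 4 and the sum into additive terms. *)
Lemma iter_linial_bits D l x i : l <= up_log 2 x ->
  iter i (linial_bits D) l <=
    (up_log 2 D).*2.*2 + 64 + 4 * iter i (up_log 2) (up_log 2 x).
Proof.
move=> lx; elim: i => [|i IH] /=; first lia.
set a := iter i _ l in IH *; set b := iter i _ _ in IH *.
set L := up_log 2 D in IH *.
apply: leq_trans (linial_bits_leq D a) _; rewrite -/L.
have ula : up_log 2 a <= up_log 2 (4 * (L + 16 + b)).
  by rewrite up_log_leE; apply: leq_trans (up_logK _); lia.
have := up_log_mul 4 (L + 16 + b); have := up_log_add (L + 16) b.
have := up_log_leq (L + 16); rewrite (_ : up_log 2 4 = 2) //; lia.
Qed.

Lemma iter_linial_bits_log_star D l x : l <= up_log 2 x ->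
  iter (log_star x) (linial_bits D) l <= (up_log 2 D).*2.*2 + 68.
Proof.
move=> /(iter_linial_bits D (log_star x)) H; apply: leq_trans H _.
have : iter (log_star x) (up_log 2) (up_log 2 x) <= 1.
  by rewrite -iterSr iterS (leq_trans (up_log_leq _)) ?iter_log_star.
by move: (iter _ _ _) => y; lia.
Qed.

(** Keeps the colors of every intermediate palette within one message. *)
Lemma iter_linial_bits_log D n l c i : D <= n -> 1 < n -> l <= c * up_log 2 n ->
  iter i (linial_bits D) l <= 64 * c.+1 * up_log 2 n.
Proof.
move=> Dn n1 lc; have u1 : 0 < up_log 2 n by rewrite up_log_gt0.
set u := up_log 2 n in lc u1 *.
have cu : c <= c * u by rewrite leq_pmulr.
have E : 64 * c.+1 * u = 64 * u + 64 * (c * u) by rewrite mulnS mulnDl mulnA.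
elim: i => [|i IH] /=; first by rewrite E; lia.
apply: leq_trans (linial_bits_leq _ _) _.
have : up_log 2 D <= u by rewrite up_log_leE (leq_trans Dn) // up_logK.
have : up_log 2 (iter i (linial_bits D) l) <= up_log 2 (64 * c.+1 * u).
  by rewrite up_log_leE; apply: leq_trans (up_logK _).
have := up_log_mul (64 * c.+1) u; have := up_log_mul 64 c.+1.
have := up_log_leq c.+1; have := up_log_leq u.
rewrite (_ : up_log 2 64 = 6) //; lia.
Qed.

(** * Colors as polynomials *)

Definition gf (a : nat) : finFieldType :=
  s2val (@pPrimePowerField 2 a.+1 isT isT).

Lemma card_gf a : #|gf a| = 2 ^ a.+1.
Proof. exact: (s2valP' (@pPrimePowerField 2 a.+1 isT isT)). Qed.

Lemma sum_pred_card (T : finType) (P : pred T) : \sum_t P t = #|P|.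
Proof. by rewrite -sum1_card [RHS]big_mkcond. Qed.

Section ColorPoly.
Local Open Scope ring_scope.
Variables (F : finFieldType) (d : nat).

Definition color_poly (y : nat) : {poly F} := rVpoly (nth 0 (enum 'rV[F]_d) y).

Lemma size_color_poly y : (size (color_poly y) <= d)%N.
Proof. exact: size_poly. Qed.

Lemma color_poly_inj y z : (y < #|F| ^ d)%N -> (z < #|F| ^ d)%N ->
  color_poly y = color_poly z -> y = z.
Proof.
rewrite -[d in (_ ^ d)%N]mul1n -(card_mx F 1 d) cardE => ltyd ltzd.
move=> /(can_inj (@rVpolyK _ _)) /eqP; rewrite nth_uniq ?enum_uniq //.
by move/eqP.
Qed.

Lemma card_agree (p r : {poly F}) (e : nat) : p != r ->
  (size p <= e.+1)%N -> (size r <= e.+1)%N -> (#|[pred t | p.[t] == r.[t]]| <= e)%N.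
Proof.
move=> neq sp sr; rewrite cardE -ltnS.
have pr0 : p - r != 0 by rewrite subr_eq0.
apply: leq_trans (max_poly_roots pr0 _ (enum_uniq _)) _.
  apply/allP=> t; rewrite mem_enum inE => /eqP eq_t.
  by rewrite rootE hornerD hornerN eq_t subrr.
by apply: leq_trans (size_polyD _ _) _; rewrite size_polyN geq_max sp sr.
Qed.

(** Neighbors of the same color are left out, since no evaluation point separates them. The new
    color encodes the chosen point and the value there. *)
Definition recolor (T : Type) (ew : T -> T -> nat)
    (x : (T * nat) * seq (T * nat)) : nat :=
  let p := color_poly x.1.2 in
  let conf (t : F) := (\sum_(y <- x.2)
    ((y.2 != x.1.2) && ((color_poly y.2).[t] == p.[t])) * ew x.1.1 y.1)%N in
  let t := [arg min_(s < 0 : F) conf s] in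
  enum_rank (t, p.[t]).

Lemma recolor_lt T (ew : T -> T -> nat) x : (recolor ew x < #|F| * #|F|)%N.
Proof. by rewrite -card_prod ltn_ord. Qed.

(* Distinct polynomials of degree < d agree in fewer than d points, so an
   average point, hence also the best one, has little conflict weight. *)
Lemma recolorP (c : nat) (N : network c) (T : Type) (ew : T -> T -> nat)
    (D : N -> T) (Y : N -> nat) (v : N) :
  (forall u, (Y u < #|F| ^ d)%N) ->
  (#|F| * \sum_(u | adj v u)
      ((Y u != Y v) && (recolor ew (view (fun w => (D w, Y w)) u)
                        == recolor ew (view (fun w => (D w, Y w)) v)))
        * ew (D v) (D u)
   <= d * \sum_(u | adj v u) ew (D v) (D u))%N.
Proof.
move=> Ylt; set X := fun w => (D w, Y w).
pose p u := color_poly (Y u).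
pose conf (t : F) := (\sum_(u | adj v u)
  ((Y u != Y v) && ((p u).[t] == (p v).[t])) * ew (D v) (D u))%N.
pose best u := [arg min_(s < 0 : F) (\sum_(y <- (view X u).2)
  ((y.2 != Y u) && ((color_poly y.2).[s] == (p u).[s])) * ew (D u) y.1)%N].
have recE u : recolor ew (view X u) = enum_rank (best u, (p u).[best u]) by [].
have bestP s : (conf (best v) <= conf s)%N.
  rewrite /best; case: arg_minnP => // t _ /(_ s isT).
  by rewrite /conf !big_view.
apply: (@leq_trans (#|F| * conf (best v))).
  rewrite leq_mul2l; apply/orP; right; apply: leq_sum => u _.
  rewrite leq_mul2r; apply/orP; right.
  (* Equal new colors mean the same point and the same value at it, so this [u] is counted in
     [conf (best v)]. *)
  case: (Y u != Y v) => //=; rewrite !recE; case: eqP => // /val_inj.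
  by move=> /enum_rank_inj [-> ->]; rewrite eqxx.
apply: (@leq_trans (\sum_t conf t)).
  by rewrite -sum_nat_const; apply: leq_sum => s _; exact: bestP.
rewrite /conf exchange_big big_distrr; apply: leq_sum => u _ /=.
rewrite -big_distrl leq_mul2r /=; apply/orP; right.
have [//|neq] := eqVneq (Y u) (Y v); first by rewrite big1.
have [d0|d0] := posnP d.
  by case/eqP: neq; move: (Ylt u) (Ylt v); rewrite d0 expn0; do 2!case: (Y _).
apply: leq_trans (_ : #|[pred t | (p u).[t] == (p v).[t]]| <= _)%N.
  by rewrite -sum_pred_card; apply: leq_sum.
apply: leq_trans (card_agree _ _ _) (leq_pred _); rewrite ?prednK ?size_color_poly //.
by apply: contra_neq neq; exact: color_poly_inj.
Qed.

End ColorPoly.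

(** * Linial's coloring *)

Definition linial (D l r : nat) (x : nat * seq nat) (y : nat) :
    prog (nat * seq nat) :=
  let bits i := iter i (linial_bits D) l in
  bind (step (fun _ => enc l y) (fun _ m => dec m) x)
    (loop r (fun i => step
      (fun z => enc (bits i.+1)
         (recolor (gf (up_log 2 (D * bits i).+1)) (bits i) (fun _ _ => 1)
            (mapk (pair tt) z)))
      (fun _ m => dec m))).

Lemma deg_leq_max (G : graph) (v : G) : \sum_(u | adj v u) 1 <= max_degree G.
Proof.
rewrite sum1_card; apply: leq_trans (leq_bigmax v).
by apply: subset_leq_card; apply/subsetP=> u; rewrite inE.
Qed.

Definition proper (G : graph) (Y : G -> nat) :=
  forall u v : G, adj u v -> Y u != Y v.

Lemma exec_linial (c : nat) (N : network c) B l r (W Y : N -> nat) :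
  let bits i := iter i (linial_bits (max_degree N)) l in
  (forall i, i <= r -> bits i <= B) -> proper Y -> (forall v, Y v < 2 ^ l) ->
  exists2 Z, exec B (fun v => linial (max_degree N) l r (view W v) (Y v)) r.+1 (view Z)
    & proper Z /\ forall v, Z v < 2 ^ bits r.
Proof.
move=> bits bitsB Yp Yl.
have e1 : exec B (fun v => step (fun _ => enc l (Y v)) (fun _ m => dec m) (view W v))
    1 (view Y).
  apply: (@exec_step _ _ _ _ _ (fun v _ => enc l (Y v)) (fun _ m => dec m)) => v.
    by rewrite size_enc; exact: (bitsB 0).
  by rewrite encK.
pose Inv i (V : N -> nat * seq nat) :=
  exists2 Z, V = view Z & proper Z /\ forall v, Z v < 2 ^ bits i.
have [||V eV [Z VE [Zp Zl]]] := @exec_loop c N B _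
  (fun (_ : N) i => step
      (fun z => enc (bits i.+1)
         (recolor (gf (up_log 2 (max_degree N * bits i).+1)) (bits i) (fun _ _ => 1)
            (mapk (pair tt) z)))
      (fun _ m => dec m)) 1 r Inv (view Y); last first.
- exists Z => //; rewrite -VE -[r.+1]add1n; rewrite muln1 in eV.
  exact: (exec_bind (Q := fun _ => loop r _) e1 eV).
- by exists Y.
move=> i V lt_ir [Z -> [Zp Zl]].
set F := gf _; pose q := #|F|.
pose Z' v := recolor F (bits i) (fun _ _ => 1) (view (fun u => (tt, Z u)) v).
have Z'l v : Z' v < 2 ^ bits i.+1.
  apply: leq_trans (recolor_lt F (bits i) _ _) _.
  by rewrite card_gf -expnD addnn.
exists (view Z'); last first.
  exists Z' => //; split=> // u v uv; apply/eqP=> eqZ.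
  have Zq w : Z w < #|F| ^ bits i.
    apply: leq_trans (Zl w) _; rewrite card_gf; by rewrite -expnM leq_pexp2l // leq_pmull.
  (* With unit weights, a clash with [u] makes the left side at least #|F|, while the right side is
     at most [bits i * max_degree N], which is smaller by the choice of the field. *)
  have := @recolorP F (bits i) c N unit (fun _ _ => 1) (fun _ => tt) Z v Zq.
  apply/negP; rewrite -ltnNge.
  apply: (@leq_ltn_trans (bits i * max_degree N)).
    by rewrite leq_mul2l deg_leq_max orbT.
  rewrite (@leq_trans #|F|) //.
    by rewrite card_gf expnS mulnC; have := up_logK (max_degree N * bits i).+1; lia.
  rewrite leq_pmulr // (bigD1 u) 1?adj_sym //= muln1.
  by rewrite -/(Z' u) -/(Z' v) eqZ eqxx Zp // andbT.
apply: (@exec_step _ _ _ _ _ (fun _ => _) (fun _ m => dec m)) => v.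
  by rewrite size_enc; exact: bitsB.
by rewrite mapk_view encK //; exact: Z'l.
Qed.

(** * Defective coloring *)

Lemma modn_exp2S y i : y %% 2 ^ i.+1 = y %% 2 ^ i + odd (y %/ 2 ^ i) * 2 ^ i.
Proof.
rewrite {1}(divn_eq y (2 ^ i)) -{1}(odd_double_half (y %/ 2 ^ i)) mulnDl.
rewrite -muln2 -mulnA -expnS -addnA addnCA modnMDl modn_small; first by rewrite addnC.
have := ltn_pmod y (expn_gt0 2 i); rewrite expnS; case: odd => /=; lia.
Qed.

Lemma big_adjC (R : Type) (idx : R) (op : Monoid.com_law idx) (G : graph)
    (F : G -> G -> R) :
  \big[op/idx]_v \big[op/idx]_(u | adj v u) F v u =
  \big[op/idx]_v \big[op/idx]_(u | adj v u) F u v.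
Proof.
under eq_bigr do rewrite big_mkcond; rewrite exchange_big /=.
apply: eq_bigr => v _; rewrite [RHS]big_mkcond; apply: eq_bigr => u _.
by rewrite adj_sym.
Qed.

(** One bit per round: [r] may depend on the accuracy, which is not bounded in terms of the network
    size, so [y] may be too long for one message. *)
Definition slow_share (T : Type) (r y : nat) (x : T * seq T) :
    prog (nat * seq nat) :=
  loop r (fun i => step (fun _ => [:: odd (y %/ 2 ^ i)])
                        (fun acc m => acc + head false m * 2 ^ i))
    (mapk (fun _ => 0) x).

Lemma exec_slow_share (c : nat) (N : network c) B r T (X : N -> T) (Y : N -> nat) :
  0 < B -> (forall v, Y v < 2 ^ r) ->
  exec B (fun v => slow_share r (Y v) (view X v)) r (view Y).
Proof.
move=> B0 Yr.
pose Inv i (V : N -> nat * seq nat) := V = view (fun v => Y v %% 2 ^ i).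
have [||V eV VE] := @exec_loop c N B _
  (fun v i => step (fun _ => [:: odd (Y v %/ 2 ^ i)])
                        (fun acc m => acc + head false m * 2 ^ i)) 1 r Inv
  (view (fun _ => 0)).
- move=> i V _ ->; eexists; last by [].
  apply: (@exec_step _ _ _ _ _ (fun v _ => _) (fun acc m => _)) => v //.
  by rewrite modn_exp2S.
- by congr view; apply: functional_extensionality => v; rewrite modn1.
rewrite muln1 in eV; suff <- : V = view Y.
  suff -> : (fun v => slow_share r (Y v) (view X v)) = (fun v => loop r (fun i =>
      step (fun _ => [:: odd (Y v %/ 2 ^ i)]) (fun acc m => acc + head false m * 2 ^ i))
      (view (fun _ => 0) v)) by exact: eV.
  by apply: functional_extensionality => v; rewrite /slow_share mapk_view.
by rewrite VE; congr view; apply: functional_extensionality => v; rewrite modn_small.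
Qed.

Section Freeze.
Variables (a : nat) (T : Type) (ew : T -> T -> nat).
Let F := gf a.
Local Notation point i := (nth 0%R (enum F) i).

(* The leading monomial makes every such polynomial nonconstant. *)
Definition freeze_poly (z : nat) : {poly F} := ('X^4 + color_poly F 4 z)%R.

Definition position (i : nat) (y : T * nat * option F) : F :=
  if y.2 is Some b then b else (freeze_poly y.1.2).[point i]%R.

(** A walking neighbor counts with its current value, a frozen one with the value at which it
    stopped. Equal polynomials never clash; such pairs are charged to the preceding recoloring. *)
Definition clash (i : nat) (y z : T * nat * option F) : bool :=
  (z.1.2 != y.1.2) && (position i z == (freeze_poly y.1.2).[point i]%R).

Definition freeze (x : (T * nat) * seq (T * nat)) :
    prog ((T * nat * option F) * seq (T * nat * option F)) :=
  loop #|F| (fun i => step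
    (fun y => [:: #|F| * (\sum_(z <- y.2) clash i y.1 z * ew y.1.1.1 z.1.1)
                  <= 8 * \sum_(z <- y.2) ew y.1.1.1 z.1.1])
    (fun y m => (y.1, if head false m then Some (position i y) else y.2)))
  (mapk (fun y => (y, None)) x).

Lemma size_freeze_poly z : size (freeze_poly z) = 5.
Proof.
rewrite /freeze_poly size_polyDl size_polyXn //.
by rewrite ltnS; exact: size_color_poly.
Qed.

Lemma sum_points (P : pred F) :
  \sum_(0 <= j < #|F|) P (point j) = #|P|.
Proof.
have <- : \sum_(t <- enum F) P t = #|P| by rewrite big_enum -sum_pred_card.
by rewrite cardE [RHS](big_nth 0%R).
Qed.

Variables (c : nat) (N : network c) (D : N -> T) (Z : N -> nat).
Hypothesis ewC : forall x y, ew x y = ew y x.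
Hypothesis Zlt : forall v, Z v < #|F| ^ 4.
Let f v := freeze_poly (Z v).
Let w v u := ew (D v) (D u).
Let tot v := \sum_(u | adj v u) w v u.

(** The leading monomials cancel, which leaves distinct polynomials of degree at most 3. *)
Lemma card_meet u v : Z u != Z v ->
  \sum_(0 <= j < #|F|) ((f u).[point j] == (f v).[point j])%R <= 3.
Proof.
move=> neq; rewrite (sum_points [pred t | (f u).[t] == (f v).[t]]%R).
have /card_agree : color_poly F 4 (Z u) != color_poly F 4 (Z v).
  by apply: contra_neq neq; exact: color_poly_inj.
move=> /(_ 3) /(_ (size_color_poly _ _ _) (size_color_poly _ _ _)).
apply: leq_trans; apply: subset_leq_card; apply/subsetP=> t; rewrite !inE.
by rewrite /f /freeze_poly !hornerD (inj_eq (addrI _)).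
Qed.

Lemma card_meet_const v b :
  \sum_(0 <= j < #|F|) ((f v).[point j] == b)%R <= 4.
Proof.
rewrite (sum_points [pred t | (f v).[t] == b]%R).
have /card_agree : f v != b%:P%R.
  apply/eqP=> /(congr1 (fun p : {poly F} => size p)).
  by rewrite size_freeze_poly size_polyC; case: (b != 0%R).
move=> /(_ 4); rewrite size_freeze_poly => /(_ isT).
have sb : size (b%:P%R : {poly F}) <= 5 by rewrite size_polyC; case: (b != 0%R).
move=> /(_ sb); apply: leq_trans.
by apply: subset_leq_card; apply/subsetP=> t; rewrite !inE hornerC.
Qed.

Definition monochrome (fr : N -> option F) (v u : N) : bool :=
  [&& Z u != Z v, isSome (fr v) & fr v == fr u].

(** The second term also counts the rounds before [u] stopped at [b]; so the total is at most 3 + 4,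
    whenever [u] stops. *)
Definition meetings i (fr : N -> option F) (v u : N) : nat :=
  \sum_(0 <= j < i) ((Z u != Z v) && ((f u).[point j] == (f v).[point j])%R)
  + (if fr u is Some b then \sum_(0 <= j < i) ((f v).[point j] == b)%R else 0).

(* As long as v is not frozen, each round costs it more than 8 tot v / #|F|
   in conflicts, while all its meetings together weigh at most 7 tot v. *)
Definition freeze_inv i (fr : N -> option F) : Prop :=
  (forall v, fr v = None ->
     i * (8 * tot v).+1 <= #|F| * \sum_(u | adj v u) meetings i fr v u * w v u) /\
  #|F| * (\sum_v \sum_(u | adj v u) monochrome fr v u * w v u)
    <= 16 * \sum_(v | isSome (fr v)) tot v.

Let st fr v : T * nat * option F := (D v, Z v, fr v).
Let K i fr v := \sum_(u | adj v u) clash i (st fr v) (st fr u) * w v u.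
Let next i fr v :=
  if #|F| * K i fr v <= 8 * tot v then Some (position i (st fr v)) else fr v.

Lemma next_some i fr v b : fr v = Some b -> next i fr v = Some b.
Proof. by move=> E; rewrite /next /position /= E if_same. Qed.

Lemma next_none i fr v :
  next i fr v = None -> 8 * tot v < #|F| * K i fr v /\ fr v = None.
Proof. by rewrite /next; case: (leqP (_ * K i fr v)). Qed.

Lemma meetings_step i fr v u :
  clash i (st fr v) (st fr u) + meetings i fr v u <= meetings i.+1 (next i fr) v u.
Proof.
rewrite /meetings /clash /position /= !big_nat_recr //= -/(f u) -/(f v).
case fru: (fr u) => [b|].
  rewrite (next_some i fru) big_nat_recr //= [(f v).[_]%R == b]eq_sym.
  case: (Z u != Z v) => /=; do 2![move: (\sum_(_ <= _ < _) _) => ?];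
    by do ?[move: (nat_of_bool _) => ?]; lia.
rewrite addn0 addnC; case: (next i fr u) => [b|]; last by rewrite addn0.
exact: leq_addr.
Qed.

(** A new monochromatic pair appears only when an endpoint stops in this round, and it is then a
    clash seen by that endpoint. *)
Lemma monochrome_step i fr v u :
  monochrome (next i fr) v u <= monochrome fr v u +
    ((fr v == None) && (next i fr v != None)) * clash i (st fr v) (st fr u) +
    ((fr u == None) && (next i fr u != None)) * clash i (st fr u) (st fr v).
Proof.
rewrite /monochrome /clash /position /= -/(f u) -/(f v) [Z v == Z u]eq_sym.
case: eqP => //= _.
case frv: (fr v) => [b|]; case fru: (fr u) => [b'|] /=.
- by rewrite (next_some i frv) (next_some i fru); lia.
- rewrite (next_some i frv) /next fru; case: ifP => //= _.
  by rewrite /position /= fru; case: eqP => // [[->]]; rewrite eqxx.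
- rewrite (next_some i fru) /next frv; case: ifP => //= _.
  by rewrite /position /= frv; case: eqP => // [[->]]; rewrite eqxx.
rewrite /next frv fru /position /= frv fru; do 2!case: ifP => //= _.
by case: eqP => // [[->]]; rewrite eqxx.
Qed.

Lemma freeze_inv_step i fr : freeze_inv i fr -> freeze_inv i.+1 (next i fr).
Proof.
case=> late mono; split=> [v /next_none [lt_K frv]|].
  apply: (@leq_trans (#|F| * K i fr v + #|F| * \sum_(u | adj v u) meetings i fr v u * w v u)).
    by rewrite mulSn leq_add ?late.
  rewrite -mulnDr leq_mul2l /K -big_split /=; apply/orP; right.
  apply: leq_sum => u _; rewrite /= -mulnDl leq_mul2r; apply/orP; right.
  exact: meetings_step.
pose fresh v := (fr v == None) && (next i fr v != None).
set M := \sum_v \sum_(u | adj v u) monochrome fr v u * w v u in mono.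
(* Over ordered pairs, a new pair may be charged to either endpoint; this factor 2 turns 8 into
   16. *)
apply: (@leq_trans (#|F| * (M + 2 * \sum_v fresh v * K i fr v))).
  rewrite leq_mul2l; apply/orP; right.
  have K1 : \sum_v fresh v * K i fr v =
      \sum_v \sum_(u | adj v u) fresh v * clash i (st fr v) (st fr u) * w v u.
    by apply: eq_bigr => v _; rewrite big_distrr; apply: eq_bigr => u _ /=; rewrite mulnA.
  have K2 : \sum_v fresh v * K i fr v =
      \sum_v \sum_(u | adj v u) fresh u * clash i (st fr u) (st fr v) * w v u.
    rewrite K1 big_adjC; apply: eq_bigr => v _; apply: eq_bigr => u _.
    by rewrite /w ewC.
  rewrite mul2n -addnn {1}K1 K2 /M -!big_split /=; apply: leq_sum => v _.
  rewrite -!big_split /=; apply: leq_sum => u _.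
  by rewrite -!mulnDl leq_mul2r addnA; apply/orP; right; exact: monochrome_step.
have freshK : #|F| * \sum_v fresh v * K i fr v <= 8 * \sum_v fresh v * tot v.
  rewrite !big_distrr; apply: leq_sum => v _ /=; rewrite /fresh /next.
  by case: ifP => [le_K|_]; case: (fr v) => [b|] /=; rewrite ?mul0n ?mul1n ?muln0.
have -> : \sum_(v | isSome (next i fr v)) tot v =
    \sum_(v | isSome (fr v)) tot v + \sum_v fresh v * tot v.
  rewrite big_mkcond [in RHS]big_mkcond -big_split; apply: eq_bigr => v _.
  rewrite /fresh; case frv: (fr v) => [b|] /=; first by rewrite (next_some i frv) addn0.
  by case: (next i fr v) => //=; rewrite mul1n.
by rewrite mulnDr mulnDr leq_add // mulnCA -[16]/(2 * 8) -mulnA leq_mul2l.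
Qed.

Lemma exec_freeze B : 0 < B ->
  exists2 fr : N -> F,
    exec B (fun v => freeze (view (fun u => (D u, Z u)) v)) #|F|
      (view (fun u => (D u, Z u, Some (fr u)))) &
    #|F| * (\sum_v \sum_(u | adj v u) ((Z u != Z v) && (fr v == fr u)) * w v u)
      <= 16 * \sum_v tot v.
Proof.
move=> B0.
pose Inv i (V : N -> (T * nat * option F) * seq (T * nat * option F)) :=
  exists2 fr, V = view (st fr) & freeze_inv i fr.
have [||V eV [fr VE [late mono]]] := @exec_loop c N B _ (fun _ i => step
    (fun y => [:: #|F| * (\sum_(z <- y.2) clash i y.1 z * ew y.1.1.1 z.1.1)
                  <= 8 * \sum_(z <- y.2) ew y.1.1.1 z.1.1])
    (fun y m => (y.1, if head false m then Some (position i y) else y.2)))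
  1 #|F| Inv (view (st (fun _ => None))).
- move=> i V _ [fr -> inv_fr]; exists (view (st (next i fr))); last first.
    by exists (next i fr) => //; exact: freeze_inv_step.
  apply: (@exec_step _ _ _ _ _ (fun _ => _) (fun y m => _)) => v //=.
  rewrite !big_view /st /next /=; congr (_, _).
- exists (fun _ => None) => //; split=> [v _ //|].
  by rewrite big1 ?muln0 // => v _; rewrite big1 // => u _; rewrite /monochrome andbF.
(* A node still walking would have seen conflicts of at least 8 tot + 1, but it meets each neighbor
   at most 3 + 4 times. The added 1 settles the case tot = 0. *)
have frS v : isSome (fr v).
  case frv: (fr v) => //; have := late v frv; rewrite leqNgt => /negP[].
  rewrite ltn_mul2l; apply/andP; split; first by apply/card_gt0P; exists 0%R.
  apply: (@leq_ltn_trans (7 * tot v)); last by rewrite ltnS leq_mul2r orbT.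
  rewrite /tot big_distrr; apply: leq_sum => u _; rewrite leq_mul2r /=.
  apply/orP; right; rewrite /meetings -[7]/(3 + 4) leq_add //.
    have [_|neq] := eqVneq (Z u) (Z v); first by rewrite big1.
    exact: card_meet.
  by case: (fr u) => // b; exact: card_meet_const.
exists (fun v => odflt 0%R (fr v)).
  rewrite muln1 in eV; have -> : (fun u => (D u, Z u, Some (odflt 0%R (fr u)))) = st fr.
    by apply: functional_extensionality => v; rewrite /st; case: (fr v) (frS v).
  rewrite -VE; set P := fun v => loop _ _ _ in eV.
  suff -> : (fun v => freeze (view (fun u => (D u, Z u)) v)) = P by [].
  by apply: functional_extensionality => v; rewrite /freeze mapk_view.
have <- : \sum_(v | isSome (fr v)) tot v = \sum_v tot v by apply: eq_bigl.
apply: leq_trans mono; rewrite leq_mul2l; apply/orP; right.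
apply: leq_sum => v _; apply: leq_sum => u _; rewrite leq_mul2r; apply/orP; right.
rewrite /monochrome; case: (fr v) (frS v) => // b _.
by case: (fr u) (frS u) => // b' _ /=; case: eqP => // ->.
Qed.

End Freeze.

(** With q = 2 ^ a.+1, the first field has q ^ 2 elements, so a point and its value make a number
    below q ^ 4. It has 4 * a.+1 bits and encodes four coefficients over the second field, whose q
    elements are the classes. *)
Definition defective (a b : nat) (T : Type) (ew : T -> T -> nat)
    (x : (T * nat) * seq (T * nat)) : prog nat :=
  bind (slow_share (4 * a.+1) (recolor (gf a.*2.+1) b ew x) x) (fun y =>
  bind (freeze a ew (pairk (mapk fst x) y)) (fun z =>
  Ret (enum_rank (odflt 0%R z.1.2) : nat))).

(** The defect 1/J, a bound on the total weight and not at each node, is spent in halves: at most b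
    / q ^ 2 on equal new colors, by [recolorP], and at most 16 / q on stopping at equal values. *)
Lemma exec_defective (c : nat) (N : network c) B a b J (T : Type)
    (ew : T -> T -> nat) (D : N -> T) (Y : N -> nat) :
  0 < B -> 32 * J <= 2 ^ a.+1 -> 2 * J * b <= 2 ^ a.+1 * 2 ^ a.+1 ->
  (forall x y, ew x y = ew y x) -> proper Y -> (forall v, Y v < 2 ^ b) ->
  exists2 k : N -> nat,
    exec B (fun v => defective a b ew (view (fun u => (D u, Y u)) v))
      (4 * a.+1 + 2 ^ a.+1) k &
    (forall v, k v < 2 ^ a.+1) /\
    J * (\sum_v \sum_(u | adj v u) (k v == k u) * ew (D v) (D u))
      <= \sum_v \sum_(u | adj v u) ew (D v) (D u).
Proof.
move=> B0 J32 Jb ewC Yp Yb; pose F1 := gf a.*2.+1; pose q := 2 ^ a.+1.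
have cF1 : #|F1| = q * q by rewrite card_gf -expnD; congr (2 ^ _); lia.
pose Z v := recolor F1 b ew (view (fun u => (D u, Y u)) v).
have Zlt v : Z v < q ^ 4.
  apply: leq_trans (recolor_lt F1 b _ _) _.
  by rewrite cF1 -!expnD -expnM leq_pexp2l //; lia.
have Zlt' v : Z v < 2 ^ (4 * a.+1) by apply: leq_trans (Zlt v) _; rewrite -expnM mulnC.
have Y1 v : Y v < #|F1| ^ b.
  apply: leq_trans (Yb v) _; rewrite cF1 -expnD -expnM leq_pexp2l //; nia.
have mono1 v := recolorP ew D v Y1.
have [|fr efr mono2] := @exec_freeze a T ew c N D Z ewC _ B B0.
  by move=> v; rewrite card_gf.
exists (fun v => enum_rank (fr v) : nat).
  apply: (exec_bind (Q := fun v y => _)).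
    exact: (exec_slow_share (fun u => (D u, Y u)) B0 Zlt').
  rewrite -[2 ^ _]addn0; apply: (exec_bind (Q := fun v z => _) (a := view (fun u => (D u, Z u, Some (fr u))))); last exact: exec_retE.
  rewrite card_gf in efr; set P := fun v => freeze a ew (view _ v) in efr.
  suff -> : (fun v => freeze a ew (pairk (mapk fst (view (fun u => (D u, Y u)) v)) (view Z v))) = P by [].
  by apply: functional_extensionality => v; rewrite mapk_view pairk_view.
split=> [v|]; first by rewrite -(card_gf a) ltn_ord.
pose S := \sum_v \sum_(u | adj v u) ew (D v) (D u).
pose S1 := \sum_v \sum_(u | adj v u) ((Y u != Y v) && (Z u == Z v)) * ew (D v) (D u).
pose S2 := \sum_v \sum_(u | adj v u) ((Z u != Z v) && (fr v == fr u)) * ew (D v) (D u).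
have S1le : 2 * J * S1 <= S.
  have : #|F1| * S1 <= b * S.
    by rewrite /S1 /S !big_distrr; apply: leq_sum => v _; exact: mono1.
  rewrite cF1 -/q => H; have q0 : 0 < q * q by rewrite muln_gt0 expn_gt0.
  rewrite -(leq_pmul2l q0); rewrite -/q in Jb.
  move: (q * q) H Jb q0 => Q H Jb Q0; nia.
have S2le : 2 * J * S2 <= S.
  rewrite card_gf -/q in mono2; rewrite -/q in J32.
  have : 32 * J * S2 <= 16 * S by apply: leq_trans mono2; rewrite leq_mul2r J32 orbT.
  lia.
have : \sum_v \sum_(u | adj v u) (enum_rank (fr v) == enum_rank (fr u) :> nat) * ew (D v) (D u)
    <= S1 + S2.
  rewrite -big_split; apply: leq_sum => v _; rewrite -big_split /=.
  apply: leq_sum => u vu; rewrite -mulnDl leq_mul2r; apply/orP; right.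
  rewrite (Yp u v) 1?adj_sym //= (inj_eq val_inj) (inj_eq enum_rank_inj).
  by case: (Z u == Z v); case: (fr v == fr u).
rewrite -/S; move: (\sum_v _) => M; nia.
Qed.

(** * Rounding *)

Section Rounding.
Local Open Scope ring_scope.
Variable R : realFieldType.

(** Only nodes with odd numerators move, so only these edges can lose by simultaneous moves. *)
Definition odd_edge (x y : nat * nat) : nat :=
  ((odd x.2 && odd y.2) * minn x.1 y.1)%N.

(* The sign of the derivative of the energy in the direction of x. *)
Definition uphill (e h : R) (x : (nat * nat) * seq (nat * nat)) : bool :=
  0 <= x.1.1%:R - (1 + e) * h * (\sum_(y <- x.2) minn x.1.1 y.1 * y.2)%N%:R.

Definition round_class (e h : R) (w : nat * seq nat) (k i : nat) :
    nat * seq nat -> prog (nat * seq nat) :=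
  step (fun M => if (k == i) && odd M.1 then [:: uphill e h (pairk w M)] else [::])
       (fun m msg => if msg is b :: _ then (if b then m.+1 else m.-1) else m).

Definition round_scale (a b : nat) (e h : R) (w col M : nat * seq nat) :
    prog (nat * seq nat) :=
  bind (defective a b odd_edge (pairk (pairk w M) col)) (fun k =>
  bind (loop (2 ^ a.+1) (round_class e h w k) M) (fun M' =>
  Ret (mapk half M'))).

(** Iteration [i] starts from numerators over 2 ^ (k - i) and leaves the surplus e * (k - i - 1) /
    k. *)
Definition rounding (a b k : nat) (e : R) (w col : nat * seq nat) :
    nat * seq nat -> prog (nat * seq nat) :=
  loop k (fun i => round_scale a b (e * (k - i.+1)%:R / k%:R) (2^-1 ^+ (k - i)) w col).

Variables (c : nat) (N : network c) (w : N -> nat).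
Local Notation A v u := (minn (w v) (w u))%:R.

(** [x] holds numerators and [h] is their unit. The double sum takes every edge twice, hence the
    half. *)
Definition energy (e h : R) (x : N -> R) : R :=
  h * (\sum_v (w v)%:R * x v) -
  (1 + e) / 2 * h ^+ 2 * \sum_v \sum_(u | adj v u) A v u * (x v * x u).

Lemma energyD e h x s :
  energy e h (fun v => x v + s v) = energy e h x
  + h * (\sum_v s v * ((w v)%:R - (1 + e) * h * \sum_(u | adj v u) A v u * x u))
  - (1 + e) / 2 * h ^+ 2 * \sum_v \sum_(u | adj v u) A v u * (s v * s u).
Proof.
have E1 : \sum_v (w v)%:R * (x v + s v) =
    \sum_v (w v)%:R * x v + \sum_v (w v)%:R * s v.
  by rewrite -big_split; apply: eq_bigr => v _; rewrite mulrDr.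
pose X := \sum_v \sum_(u | adj v u) A v u * (s v * x u).
have E2 : \sum_v \sum_(u | adj v u) A v u * ((x v + s v) * (x u + s u)) =
    \sum_v \sum_(u | adj v u) A v u * (x v * x u) + (X + X)
    + \sum_v \sum_(u | adj v u) A v u * (s v * s u).
  have XE : X = \sum_v \sum_(u | adj v u) A v u * (s u * x v).
    by rewrite /X big_adjC; under eq_bigr do under eq_bigr do rewrite minnC.
  rewrite {1}XE /X -!big_split; apply: eq_bigr => v _ /=.
  by rewrite -!big_split; apply: eq_bigr => u _ /=; ring.
have E3 : \sum_v s v * ((w v)%:R - (1 + e) * h * \sum_(u | adj v u) A v u * x u)
   = \sum_v (w v)%:R * s v - (1 + e) * h * X.
  rewrite mulr_sumr -sumrB; apply: eq_bigr => v _.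
  rewrite mulrBr mulrC; congr (_ - _); rewrite mulrCA; congr (_ * _).
  by rewrite mulr_sumr; apply: eq_bigr => u _; ring.
by rewrite /energy E1 E2 E3; field.
Qed.

Local Notation natf M := (fun v : N => (M v)%:R : R).

Lemma energy_half e h (M : N -> nat) : (forall v, ~~ odd (M v)) ->
  energy e (2 * h) (natf (fun v => (M v)./2)) = energy e h (natf M).
Proof.
move=> Mev; have ME v : (M v)%:R = 2 * ((M v)./2)%:R :> R.
  by rewrite -natrM mul2n -[LHS](congr1 _ (odd_double_half (M v))) (negbTE (Mev v)).
have -> : natf M = (fun v => 2 * ((M v)./2)%:R).
  by apply: functional_extensionality.
rewrite /energy; under [in RHS]eq_bigr do rewrite mulrCA.
rewrite -[in RHS]mulr_sumr.
have -> : \sum_v \sum_(u | adj v u) A v u * (2 * ((M v)./2)%:R * (2 * ((M u)./2)%:R))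
    = 4 * \sum_v \sum_(u | adj v u) A v u * (((M v)./2)%:R * ((M u)./2)%:R) :> R.
  rewrite mulr_sumr; apply: eq_bigr => v _; rewrite mulr_sumr.
  by apply: eq_bigr => u _; ring.
by field.
Qed.

Section Classes.
Variables (e h : R) (M0 : N -> nat) (k : N -> nat).
Hypotheses (e0 : 0 <= e) (h0 : 0 <= h).

Let edge0 v u := (odd_edge (w v, M0 v) (w u, M0 u))%:R : R.
(** The subtracted sum is the price of simultaneous moves in the classes below [i]. It refers to
    [M0] because a node keeps its numerator until its class comes. *)
Definition round_inv i (M : N -> nat) : Prop :=
  [/\ forall v, (i <= k v)%N -> M v = M0 v,
      forall v, (k v < i)%N -> ~~ odd (M v),
      forall v, (M v <= M0 v + odd (M0 v))%N &
      energy e h (natf M0) - (1 + e) / 2 * h ^+ 2 *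
        (\sum_v \sum_(u | adj v u) ((k v == k u) && (k v < i)%N)%:R * edge0 v u)
      <= energy e h (natf M)].

Let next i (M : N -> nat) v : nat :=
  if (k v == i) && odd (M v) then
    if uphill e h (view (fun u => (w u, M u)) v) then (M v).+1 else (M v).-1
  else M v.

Lemma round_inv_step i M : round_inv i M -> round_inv i.+1 (next i M).
Proof.
case=> Mlate Mearly Mle Men.
pose s v : R := (next i M v)%:R - (M v)%:R.
have sE v : s v = ((k v == i) && odd (M v))%:R *
    (if uphill e h (view (fun u => (w u, M u)) v) then 1 else -1).
  rewrite /s /next; case: ifP => [/andP[_ oM]|_]; last by rewrite mul0r subrr.
  rewrite /= mul1r; case: ifP => _; first by rewrite -natr1; ring.
  by case: (M v) oM => // m _; rewrite -natr1 /=; ring.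
split.
- move=> v lt_ik; rewrite /next; case: eqP => [E|_] /=; first by lia.
  by apply: Mlate; lia.
- move=> v; rewrite ltnS leq_eqVlt /next; case: (k v =P i) => [_|_] /=.
    by case: ifP => [oM _|->//]; case: ifP => _ /=; [rewrite oM|case: (M v) oM => //= m; rewrite negbK].
  exact: Mearly.
- move=> v; rewrite /next; case: ifP => [/andP[/eqP ki oM]|//].
  have E := Mlate v; rewrite ki leqnn in E; rewrite -(E isT) oM.
  by case: ifP => _; lia.
have -> : natf (next i M) = (fun v => (M v)%:R + s v).
  by apply: functional_extensionality => v; rewrite /s; ring.
rewrite energyD.
set X := \sum_v \sum_(u | _) _ in Men; set G := \sum_v s v * _.
set S := \sum_v \sum_(u | _) _ * (s v * s u).
set X' := \sum_v \sum_(u | _) _.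
(* To first order no move lowers the energy, as each follows the sign of its derivative. *)
have G0 : 0 <= G.
  apply: sumr_ge0 => v _; rewrite sE; case: eqP => [ki|_]; last by rewrite !mul0r.
  rewrite /uphill big_view natr_sum /=.
  under [X in _ - _ * X]eq_bigr do rewrite natrM.
  case: odd; rewrite ?mul0r // mul1r; case: ifP => [|/negbT]; first by rewrite mul1r.
  by rewrite -ltNge => /ltW; rewrite mulN1r oppr_ge0.
(* Second-order terms come only from pairs moving together, both in class [i] with odd numerators;
   there [s v * s u] is 1 or -1. *)
have XS : X + S <= X'.
  rewrite /X /S /X' -big_split; apply: ler_sum => v _ /=; rewrite -big_split.
  apply: ler_sum => u _ /=; rewrite !sE /edge0 /odd_edge /= !natrM.
  have A0 : 0 <= A v u :> R by [].
  set sg := (if _ then 1 else -1 : R); set sg' := (if _ then 1 else -1 : R).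
  have sgP : `|sg * sg'| = 1.
    by rewrite /sg /sg'; do 2!case: ifP => _; rewrite ?mulr1 ?mul1r ?mulN1r ?opprK ?normrN normr1.
  have [/andP[/eqP kv /eqP ku]|] := boolP ((k v == i) && (k u == i)).
    have := Mlate v; have := Mlate u; rewrite kv ku leqnn => -> // -> //.
    rewrite ltnn ltnSn !eqxx /= mul0r add0r mul1r.
    do 2!case: odd; rewrite ?mul0r ?mulr0 ?mul1r //.
    by rewrite ler_piMr // (le_trans (ler_norm _)) // sgP.
  rewrite negb_and => /orP[] /negbTE -> /=; rewrite ?mul0r ?mulr0 addr0 ltnS;
    rewrite ler_wpM2r ?mulr_ge0 // ler_nat;
    by case: eqP => //= _; case: ltnP => // /ltnW ->.
have c0 : 0 <= (1 + e) / 2 * h ^+ 2 by rewrite mulr_ge0 ?exprn_ge0 // divr_ge0 ?addr_ge0.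
move: Men (ler_wpM2l c0 XS) (mulr_ge0 h0 G0); rewrite mulrDr.
by move: (energy _ _ _) (energy _ _ _) => en0 en1; lra.
Qed.

Lemma exec_round_classes B n : (0 < B)%N -> (forall v, k v < n)%N ->
  exists2 M, exec B (fun v => loop n (round_class e h (view w v) (k v)) (view M0 v))
      n (view M) & round_inv n M.
Proof.
move=> B0 kn.
pose Inv i (V : N -> nat * seq nat) := exists2 M, V = view M & round_inv i M.
have [||V eV [M VE inv_M]] := @exec_loop c N B _
  (fun v => round_class e h (view w v) (k v)) 1 n Inv (view M0).
- move=> i V _ [M -> inv_M]; exists (view (next i M)); last first.
    by exists (next i M) => //; exact: round_inv_step.
  apply: (@exec_step _ _ _ _ _ (fun v _ => _) (fun m msg => _)) => v.
    by case: ifP.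
  by rewrite /next pairk_view /=; case: (_ && _).
- exists M0 => //; split=> // [v|]; first exact: leq_addr.
  rewrite big1 ?mulr0 ?subr0 // => v _; rewrite big1 // => u _.
  by rewrite andbF mul0r.
by exists M => //; rewrite -VE; rewrite muln1 in eV.
Qed.

End Classes.

(** Lowering e to e' frees (e - e') / 2 * h ^ 2 times the quadratic sum, and the moves cost (1 + e')
    / 2 * h ^ 2 times the same-class odd weight. Odd numerators are at least 1, so by the defect
    this weight is at most 1/J of the sum, and the last hypothesis balances the two. *)
Lemma exec_round_scale B a b J (e e' h : R) (col M0 : N -> nat) :
  (0 < B)%N -> (32 * J <= 2 ^ a.+1)%N -> (2 * J * b <= 2 ^ a.+1 * 2 ^ a.+1)%N ->
  proper col -> (forall v, col v < 2 ^ b)%N -> 0 <= e' -> 0 <= h ->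
  1 + e' <= J%:R * (e - e') ->
  exists2 M, exec B (fun v => round_scale a b e' h (view w v) (view col v) (view M0 v))
      (4 * a.+1 + 2 ^ a.+1 + 2 ^ a.+1) (view M) &
    (forall v, M v <= uphalf (M0 v))%N /\
    energy e h (natf M0) <= energy e' (2 * h) (natf M).
Proof.
move=> B0 J32 Jb colp colb e0 h0 Je.
have [|k ek [klt kmono]] := exec_defective (fun u => (w u, M0 u)) B0 J32 Jb _ colp colb
  (ew := odd_edge).
  by move=> x y; rewrite /odd_edge andbC minnC.
have [M' eM' [_ Mev Mle Men]] := exec_round_classes M0 e0 h0 B0 klt.
exists (fun v => (M' v)./2); last split.
- apply: (exec_bind (Q := fun v k => _) (a := k)).
    set P := (fun v => defective _ _ _ _) in ek.
    suff -> : (fun v => defective a b odd_edge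
      (pairk (pairk (view w v) (view M0 v)) (view col v))) = P by [].
    by apply: functional_extensionality => v; rewrite !pairk_view.
  rewrite -[X in exec _ _ X]addn0.
  apply: (exec_bind (Q := fun v k => _) (a := view M')) => //.
  by apply: exec_ret => v; rewrite mapk_view.
- by move=> v; rewrite uphalf_half; have := Mle v; have := odd_double_half (M0 v); lia.
rewrite (energy_half e' h (M := M')); last by move=> v; exact: Mev.
apply: le_trans Men.
set X := \sum_v \sum_(u | _) _.
pose Q : R := \sum_v \sum_(u | adj v u) A v u * ((M0 v)%:R * (M0 u)%:R).
have JX : J%:R * X <= Q.
  have -> : X = (\sum_v \sum_(u | adj v u)
      (k v == k u) * odd_edge (w v, M0 v) (w u, M0 u))%N%:R.
    rewrite natr_sum; apply: eq_bigr => v _; rewrite natr_sum; apply: eq_bigr => u _.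
    by rewrite klt andbT natrM.
  rewrite -natrM; apply: (le_trans (y := (\sum_v \sum_(u | adj v u)
    odd_edge (w v, M0 v) (w u, M0 u))%N%:R)); first by rewrite ler_nat.
  rewrite natr_sum; apply: ler_sum => v _; rewrite natr_sum; apply: ler_sum => u _.
  rewrite /odd_edge /= -natrM -natrM ler_nat mulnC leq_mul2l; apply/orP; right.
  by case: (M0 v) => // m; case: (M0 u) => [|m']; rewrite ?andbF //= mulnS; case: (_ && _).
have -> : energy e h (natf M0) = energy e' h (natf M0) - (e - e') / 2 * h ^+ 2 * Q.
  by rewrite /energy -/Q; field.
have X0 : 0 <= X.
  by apply: sumr_ge0 => v _; apply: sumr_ge0 => u _; rewrite mulr_ge0.
have ee : 0 <= e - e'.
  rewrite leNgt; apply/negP=> neg; have J0 : 0 <= J%:R :> R by [].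
  by have := mulr_ge0_le0 J0 (ltW neg); lra.
have H : (1 + e') * X <= (e - e') * Q.
  apply: le_trans (ler_wpM2r X0 Je) _.
  by rewrite (_ : J%:R * _ * X = (e - e') * (J%:R * X)) ?ler_wpM2l //; ring.
have h2 : 0 <= 2^-1 * h ^+ 2 by rewrite mulr_ge0 ?exprn_ge0 ?invr_ge0.
by have := ler_wpM2l h2 H; rewrite lerD2l lerN2 => ?; lra.
Qed.

End Rounding.

(** * From an integral point to an independent set *)

Definition beats (y z : nat * nat) : bool :=
  (y.1 < z.1) || ((y.1 == z.1) && (y.2 < z.2)).

Definition resolve (x : (nat * nat * nat) * seq (nat * nat * nat)) : bool :=
  [&& x.1.2 == 1, 0 < x.1.1.1 &
      ~~ has (fun y => (y.2 == 1) && beats x.1.1 y.1) x.2].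

Definition round_is (R : realFieldType) (a b k : nat) (e : R)
    (w col M : nat * seq nat) : prog (bool * seq bool) :=
  bind (rounding a b k e w col M)
    (step (fun x => [:: resolve (pairk (pairk w col) x)]) (fun _ => head false)).

Definition indep (G : graph) (S : G -> bool) : Prop :=
  forall u v, adj u v -> S u -> ~~ S v.

Lemma has_view (c : nat) (N : network c) T (p : pred T) (X : N -> T) v :
  reflect (exists2 u, adj v u & p (X u)) (has p (view X v).2).
Proof.
rewrite has_map; apply: (iffP hasP) => -[u uv pu]; exists u => //.
  by rewrite -mem_ports.
by rewrite mem_ports.
Qed.

Section Resolve.
Variables (c : nat) (N : network c) (w col M : N -> nat).
Hypothesis colp : proper col.
Let rec v := ((w v, col v), M v).
Let S v := resolve (view rec v).

(** The proper color breaks ties between equal weights, so every edge has exactly one winner. *)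
Lemma beatsC u v : adj u v ->
  beats (w u, col u) (w v, col v) = ~~ beats (w v, col v) (w u, col u).
Proof. by move=> /colp; rewrite /beats /=; case: (ltngtP (w u)); case: (ltngtP (col u)). Qed.

Lemma resolve_pos v : S v -> 0 < w v.
Proof. by case/and3P. Qed.

Lemma resolve_indep : indep S.
Proof.
move=> u v uv /and3P[/= /eqP Mu wu /has_view nu]; apply/negP.
case/and3P=> /= /eqP Mv wv /has_view[]; exists u; rewrite ?(adj_sym v) //= Mu /=.
rewrite beatsC 1?adj_sym //; apply/negP=> b_uv; apply: nu.
by exists v; rewrite //= Mv.
Qed.

Lemma resolve_max v : M v = 1 -> 0 < w v -> ~~ S v ->
  exists2 u, adj v u & (M u == 1) && beats (w v, col v) (w u, col u).
Proof.
by move=> Mv wv; rewrite /S /resolve /= Mv wv negbK => /has_view.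
Qed.

(** A losing [v] has a neighbor of value 1 that is not lighter, so [w v] is the minimum on that
    edge. Only the loser charges an edge, which uses half of the ordered double sum. *)
Lemma resolve_weight : (forall v, M v <= 1) ->
  2 * (\sum_v w v * M v) <= 2 * (\sum_(v | S v) w v)
    + \sum_v \sum_(u | adj v u) minn (w v) (w u) * (M v * M u).
Proof.
move=> M1; pose bt v u := beats (w v, col v) (w u, col u).
pose t v u := bt v u * (minn (w v) (w u) * (M v * M u)).
apply: (@leq_trans (2 * (\sum_(v | S v) w v) + 2 * \sum_v \sum_(u | adj v u) t v u)).
  rewrite -mulnDr leq_mul2l /= [\sum_(v | S v) _]big_mkcond -big_split.
  apply: leq_sum => v _ /=; case: ifP => Sv.
    by apply: leq_trans (leq_addr _ _); rewrite -{2}[w v]muln1 leq_mul2l M1 orbT.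
  case: (posnP (w v)) => [->//|wv].
  case: (M v =P 1) => [Mv|/eqP Mv]; last by have := M1 v; case: (M v) Mv => [|[]]; rewrite ?muln0.
  have [u vu /andP[/eqP Mu buv]] := resolve_max Mv wv (negbT Sv).
  rewrite (bigD1 u) //= add0n; apply: leq_trans (leq_addr _ _).
  rewrite /t /bt buv Mv Mu !muln1 mul1n leq_min leqnn /=.
  by case/orP: buv => /= [/ltnW //|/andP[/eqP-> _]].
rewrite leq_add2l mul2n -addnn {1}big_adjC -big_split; apply: leq_sum => v _ /=.
rewrite -big_split; apply: leq_sum => u vu /=; rewrite /t /bt [minn (w u) _]minnC [M u * _]mulnC.
by rewrite -mulnDl (beatsC vu); case: beats; rewrite mul1n.
Qed.

End Resolve.

Section RoundIS.
Local Open Scope ring_scope.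
Variables (R : realFieldType) (c : nat) (N : network c) (w col M0 : N -> nat).
Local Notation natf M := (fun v : N => (M v)%:R : R).

Definition round_time (a k : nat) : nat :=
  (k * (4 * a.+1 + 2 ^ a.+1 + 2 ^ a.+1))%N.

(** Each of the k scales lowers e by e / k. As 1 + e' is at most 2, a defect 1/J with J at least 2 k
    / e is affordable. *)
Lemma exec_rounding B a b J k (e : R) :
  (0 < B)%N -> (32 * J <= 2 ^ a.+1)%N -> (2 * J * b <= 2 ^ a.+1 * 2 ^ a.+1)%N ->
  proper col -> (forall v, col v < 2 ^ b)%N -> 0 <= e <= 1 -> (0 < k)%N ->
  2 * k%:R <= J%:R * e -> (forall v, M0 v <= 2 ^ k)%N ->
  exists2 M, exec B (fun v => rounding a b k e (view w v) (view col v) (view M0 v))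
      (round_time a k) (view M) &
    (forall v, M v <= 1)%N /\
    energy w e (2^-1 ^+ k) (natf M0) <= energy w 0 1 (natf M).
Proof.
move=> B0 J32 Jb colp colb /andP[e0 e1] k0 Je M0k.
have kR : 0 < k%:R :> R by rewrite ltr0n.
pose Inv i (V : N -> nat * seq nat) := exists2 M, V = view M &
  (forall v, M v <= 2 ^ (k - i))%N /\
  energy w e (2^-1 ^+ k) (natf M0) <=
  energy w (e * (k - i)%:R / k%:R) (2^-1 ^+ (k - i)) (natf M).
have [||V eV [M VE [M1 Men]]] := @exec_loop c N B _ (fun v i => round_scale a b
  (e * (k - i.+1)%:R / k%:R) (2^-1 ^+ (k - i)) (view w v) (view col v))
  (4 * a.+1 + 2 ^ a.+1 + 2 ^ a.+1) k Inv (view M0).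
- move=> i V ik [M -> [Mi Men]].
  have ki : (k - i = (k - i.+1).+1)%N by lia.
  have [|||M' eM' [M'M M'en]] := @exec_round_scale R c N w B a b J
    (e * (k - i)%:R / k%:R) (e * (k - i.+1)%:R / k%:R) (2^-1 ^+ (k - i)) col M
    B0 J32 Jb colp colb.
  + by rewrite !mulr_ge0 ?invr_ge0 // ltW.
  + by rewrite exprn_ge0 ?invr_ge0.
  + have -> : e * (k - i)%:R / k%:R - e * (k - i.+1)%:R / k%:R = e / k%:R.
      by rewrite -mulrBl -mulrBr ki -natr1; ring.
    apply: (@le_trans _ _ 2).
      rewrite -[2]/(1 + 1) lerD2l ler_pdivrMr // mul1r.
      apply: le_trans (ler_piMl _ e1) _ => //; first by rewrite ler_nat leq_subr.
    by rewrite mulrA ler_pdivlMr.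
  exists (view M') => //; exists M' => //; split=> [v|].
    apply: leq_trans (M'M v) _; rewrite leq_uphalf_double.
    by have := Mi v; rewrite ki expnS mul2n.
  apply: le_trans Men (le_trans M'en _).
  by rewrite ki exprS mulrA divff ?mul1r // pnatr_eq0.
- exists M0 => //; split=> //; first by rewrite subn0.
  by rewrite subn0 mulfK // gt_eqF.
exists M; first by rewrite -VE.
by move: M1 Men; rewrite subnn expr0 mulr0 mul0r.
Qed.

Lemma exec_round_is B a b J k (e : R) :
  (0 < B)%N -> (32 * J <= 2 ^ a.+1)%N -> (2 * J * b <= 2 ^ a.+1 * 2 ^ a.+1)%N ->
  proper col -> (forall v, col v < 2 ^ b)%N -> 0 <= e <= 1 -> (0 < k)%N ->
  2 * k%:R <= J%:R * e -> (forall v, M0 v <= 2 ^ k)%N ->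
  exists2 S, exec B (fun v => round_is a b k e (view w v) (view col v) (view M0 v))
      (round_time a k).+1 (view S) &
    [/\ indep S, forall v, S v -> (0 < w v)%N &
      energy w e (2^-1 ^+ k) (natf M0) <= (\sum_(v | S v) w v)%N%:R].
Proof.
move=> B0 J32 Jb colp colb e01 k0 Je M0k.
have [M eM [M1 Men]] := exec_rounding B0 J32 Jb colp colb e01 k0 Je M0k.
exists (fun v => resolve (view (fun u => ((w u, col u), M u)) v)); last split.
- rewrite -addn1; apply: exec_bind eM _.
  apply: (@exec_step _ _ _ _ _ (fun v _ => _) (fun _ => _)) => v //=.
  by rewrite !pairk_view.
- exact: resolve_indep.
- by move=> v; exact: resolve_pos.
apply: le_trans Men _.
have := resolve_weight w colp M1; rewrite -(ler_nat R) natrD !(natrM _ 2).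
rewrite /energy mul1r expr1n mulr1 addr0.
have -> : (\sum_v w v * M v)%N%:R = \sum_v (w v)%:R * (M v)%:R :> R.
  by rewrite natr_sum; apply: eq_bigr => v _; rewrite natrM.
have -> : (\sum_v \sum_(u | adj v u) minn (w v) (w u) * (M v * M u))%N%:R =
    \sum_v \sum_(u | adj v u) (minn (w v) (w u))%:R * ((M v)%:R * (M u)%:R) :> R.
  rewrite natr_sum; apply: eq_bigr => v _; rewrite natr_sum; apply: eq_bigr => u _.
  by rewrite !natrM.
by move=> ?; lra.
Qed.

End RoundIS.

(** * Fractional independent sets relative to OPT / beta *)

(* Buckets of weights are handled from heavy to light; in its bucket a node doubles
   its value until the load of its closed neighborhood reaches 2 ^ k / 8. *)
Definition grow (k i : nat) (w : nat * seq nat) :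
    nat * seq nat -> prog (nat * seq nat) :=
  step (fun M => [:: [&& 0 < w.1, trunc_log 2 w.1 == i &
                        M.1 + \sum_(m <- M.2) m < 2 ^ (k - 3)]])
       (fun m b => if head false b then maxn 1 m.*2 else m).

Definition greedy_frac (k L : nat) (w : nat * seq nat) : prog (nat * seq nat) :=
  loop L.+1 (fun i => loop (k - 2) (fun _ => grow k (L - i) w)) (mapk (fun _ => 0) w).

Section GreedyFrac.
Variables (c : nat) (N : network c) (w : N -> nat) (k : nat).
Hypotheses (k3 : 3 <= k) (Dk : max_degree N <= 2 ^ (k - 3)).
Let th := 2 ^ (k - 3).

Definition util (M : N -> nat) : nat := \sum_v w v * M v.
Definition quad (M : N -> nat) : nat :=
  \sum_v \sum_(u | adj v u) minn (w v) (w u) * (M v * M u).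
Definition load (M : N -> nat) v : nat := M v + \sum_(u | adj v u) M u.

(** Over the denominator 2 ^ k: the closed neighborhood of [v] carries at least [w v] / 16. This
    local condition yields the global comparison in [covered_weight]. *)
Definition covered (M : N -> nat) v : Prop :=
  w v * th <= 2 * (w v * M v + \sum_(u | adj v u) w u * M u).

Let bucket v := trunc_log 2 (w v).
Let next i (M : N -> nat) v : nat :=
  if [&& 0 < w v, bucket v == i & load M v < th] then maxn 1 (M v).*2 else M v.

Lemma next_ge i M v : M v <= next i M v.
Proof. by rewrite /next; case: ifP => // _; rewrite leq_max -addnn leq_addr orbT. Qed.

Lemma covered_mono M M' v : (forall u, M u <= M' u) -> covered M v -> covered M' v.
Proof.
move=> le; rewrite /covered => /leq_trans -> //; rewrite leq_mul2l leq_add //=.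
  by rewrite leq_mul2l le orbT.
by apply: leq_sum => u _; rewrite leq_mul2l le orbT.
Qed.

(** One unit of growth at [v] adds at most [w v] times twice the values of its neighbors plus their
    growth. As [v] grows only while its load is below [th], that factor is at most 3 * th +
    max_degree N <= 4 * th = 2 ^ k.-1. *)
Lemma quad_next i M :
  quad M <= 2 ^ k.-1 * util M -> quad (next i M) <= 2 ^ k.-1 * util (next i M).
Proof.
move=> QM; pose d v := next i M v - M v.
have nE v : next i M v = M v + d v by rewrite subnKC ?next_ge.
have dM v : d v <= (M v).+1.
  by rewrite /d /next; case: ifP => _; [case: (M v) => [|m]; lia|lia].
have dload v : d v * (2 * (\sum_(u | adj v u) M u) + \sum_(u | adj v u) d u)
    <= d v * 2 ^ k.-1.
  have [->//|dv] := posnP (d v); rewrite leq_mul2l; apply/orP; right.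
  have lv : load M v < th.
    by move: dv; rewrite /d /next; case: ifP => [/and3P[]//|_]; rewrite subnn.
  have : \sum_(u | adj v u) d u <= \sum_(u | adj v u) M u + max_degree N.
    apply: (@leq_trans (\sum_(u | adj v u) (M u + 1))).
      by apply: leq_sum => u _; rewrite addn1.
    by rewrite big_split leq_add2l deg_leq_max.
  rewrite (_ : 2 ^ k.-1 = 4 * th); last by rewrite -(expnD 2 2); congr (2 ^ _); lia.
  by move: lv (Dk); rewrite /load -/th; lia.
have -> : util (next i M) = util M + \sum_v w v * d v.
  by rewrite /util -big_split; apply: eq_bigr => v _; rewrite nE mulnDr.
pose X v := 2 * (\sum_(u | adj v u) M u) + \sum_(u | adj v u) d u.
have -> : quad (next i M) = quad M +
    \sum_v \sum_(u | adj v u) minn (w v) (w u) * (d v * (2 * M u + d u)).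
  pose Y := \sum_v \sum_(u | adj v u) minn (w v) (w u) * (d v * M u).
  have YE : Y = \sum_v \sum_(u | adj v u) minn (w v) (w u) * (d u * M v).
    by rewrite /Y big_adjC; under eq_bigr do under eq_bigr do rewrite minnC.
  have -> : \sum_v \sum_(u | adj v u) minn (w v) (w u) * (d v * (2 * M u + d u)) =
      Y + Y + \sum_v \sum_(u | adj v u) minn (w v) (w u) * (d v * d u).
    rewrite /Y -!big_split; apply: eq_bigr => v _ /=; rewrite -!big_split.
    by apply: eq_bigr => u _ /=; rewrite -!mulnDr mul2n -addnn; congr (_ * _); lia.
  rewrite {1}YE /Y /quad -!big_split; apply: eq_bigr => v _ /=; rewrite -!big_split.
  by apply: eq_bigr => u _ /=; rewrite !nE -!mulnDr; congr (_ * _); lia.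
rewrite mulnDr leq_add // big_distrr; apply: leq_sum => v _ /=.
apply: (@leq_trans (w v * (d v * X v))); last first.
  by rewrite [leqRHS]mulnCA leq_mul2l [2 ^ _ * _]mulnC dload orbT.
rewrite /X big_distrr -big_split 2!big_distrr; apply: leq_sum => u _ /=.
by rewrite leq_mul2r geq_minl orbT.
Qed.
(** The state of bucket [i] after [j] rounds of growth; (2 ^ j)./2 is 0 before the first round,
    which lifts the value to 1. *)
Definition sweep_inv i j (M : N -> nat) : Prop :=
  [/\ forall v, M v <= 2 ^ (k - 2),
      forall u, 0 < M u -> 0 < w u /\ i <= bucket u,
      quad M <= 2 ^ k.-1 * util M,
      forall v, 0 < w v -> i < bucket v -> covered M v &
      forall v, 0 < w v -> bucket v = i -> covered M v \/ (2 ^ j)./2 <= M v].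

Lemma sweep_step i j M : sweep_inv i j M -> sweep_inv i j.+1 (next i M).
Proof.
case=> M2 Mi MQ Mlt Meq; split.
- move=> v; rewrite /next; case: ifP => // /and3P[_ _]; rewrite /load.
  have -> : 2 ^ (k - 2) = 2 * th by rewrite -expnS; congr (2 ^ _); lia.
  by have := expn_gt0 2 (k - 3); rewrite -/th; lia.
- move=> u; rewrite /next; case: ifP => [/and3P[wu /eqP -> _] //|_]; exact: Mi.
- exact: quad_next.
- by move=> v wv iv; apply: covered_mono (Mlt v wv iv) => u; exact: next_ge.
move=> v wv iv; case: (Meq v wv iv) => [cv|Mv].
  by left; apply: covered_mono cv => u; exact: next_ge.
have [lt_load|ge_load] := ltnP (load M v) th; last left.
  right; rewrite /next wv iv eqxx lt_load /= leq_max.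
  have half_exp2 n : (2 ^ n.+1)./2 = 2 ^ n by rewrite expnS mul2n doubleK.
  move: Mv; rewrite half_exp2; case: (j) => [|j'] //.
  by rewrite half_exp2 expnS => ?; apply/orP; right; lia.
apply: (@covered_mono M) => [u|]; first exact: next_ge.
(* Positive values so far sit in buckets not below that of [v], at weights of at least half of
   [w v]; this is the factor 2 in [covered]. *)
have le_w u : w v * M u <= 2 * (w u * M u).
  have [->|Mu] := posnP (M u); first by rewrite !muln0.
  have [wu iu] := Mi u Mu; rewrite mulnA leq_mul2r; apply/orP; right.
  apply: ltnW; apply: (leq_trans (trunc_log_ltn (w v) (isT : 1 < 2))).
  by rewrite expnS leq_mul2l /= (leq_trans _ (trunc_logP (isT : 1 < 2) wu)) // leq_pexp2l // -/(bucket v) iv.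
rewrite /covered; apply: (@leq_trans (w v * load M v)); first by rewrite leq_mul2l ge_load orbT.
rewrite /load !mulnDr leq_add // 2!big_distrr; apply: leq_sum => u _; exact: le_w.
Qed.

Lemma exec_greedy_frac B L : 0 < B -> (forall v, bucket v <= L) ->
  exists2 M, exec B (fun v => greedy_frac k L (view w v)) (L.+1 * (k - 2)) (view M) &
    [/\ forall v, M v <= 2 ^ k, quad M <= 2 ^ k.-1 * util M &
        forall v, covered M v].
Proof.
move=> B0 wL.
pose Inv t (V : N -> nat * seq nat) := exists2 M, V = view M &
  [/\ forall v, M v <= 2 ^ (k - 2),
      forall u, 0 < M u -> 0 < w u /\ L < bucket u + t,
      quad M <= 2 ^ k.-1 * util M &
      forall v, 0 < w v -> L < bucket v + t -> covered M v].
have [||V eV [M VE [M2 _ MQ Mc]]] := @exec_loop c N B _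
  (fun v i => loop (k - 2) (fun _ => grow k (L - i) (view w v))) (k - 2) L.+1 Inv
  (view (fun _ => 0)).
- move=> t V tL [M -> [M2 Mi MQ Mc]]; set i := L - t.
  pose Inv' j (V : N -> nat * seq nat) := exists2 M, V = view M & sweep_inv i j M.
  have [||V' eV' [M' VE' [M2' Mi' MQ' Mlt Meq]]] := @exec_loop c N B _
    (fun v _ => grow k i (view w v)) 1 (k - 2) Inv' (view M).
  + move=> j V' _ [M' -> inv]; exists (view (next i M')); last first.
      by exists (next i M') => //; exact: sweep_step.
    by apply: (@exec_step _ _ _ _ _ (fun v _ => _) (fun m b => _)) => v //=; rewrite big_view.
  + exists M => //; split=> // [u /Mi[wu lt]|v wv iv|v wv iv]; last by right.
      by split=> //; rewrite /i; lia.
    by apply: Mc => //; rewrite /i in iv *; lia.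
  exists V'; first by rewrite muln1 in eV'.
  exists M' => //; split=> // [u /Mi'[wu iu]|v wv iv].
    by split=> //; rewrite /i in iu; lia.
  have [lt|] := ltnP i (bucket v); first exact: Mlt.
  move=> ge; have bi : bucket v = i by have iE : i = L - t := erefl; lia.
  (* A node not covered earlier has been doubled up to [th] and covers itself. *)
  case: (Meq v wv bi) => // le.
  rewrite /covered; apply: (@leq_trans (2 * (w v * M' v))); last by rewrite leq_mul2l leq_addr orbT.
  rewrite mulnCA leq_mul2l; apply/orP; right; apply: (@leq_trans (M' v)); last by lia.
  apply: leq_trans le; rewrite /th (_ : k - 2 = (k - 3).+1); last by lia.
  by rewrite expnS mul2n doubleK.
- exists (fun _ => 0) => //; split=> //.
  + by rewrite /quad big1 // => v _; rewrite big1 // => u _; rewrite !muln0.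
  + by move=> v _; have := wL v; lia.
exists M; last split=> //.
- rewrite -VE; set P := fun v => loop _ _ _ in eV.
  suff -> : (fun v => greedy_frac k L (view w v)) = P by [].
  by apply: functional_extensionality => v; rewrite /greedy_frac mapk_view.
- by move=> v; apply: leq_trans (M2 v) _; rewrite leq_pexp2l // leq_subr.
move=> v; have [wv|wv] := posnP (w v); first by rewrite /covered wv.
by apply: Mc => //; lia.
Qed.

(** Summed over [O], the covering condition charges the value at a node once for every member of [O]
    in its closed neighborhood, hence at most [B] times. *)
Lemma covered_weight B (O : {set N}) (M : N -> nat) :
  (forall v, (v \in O) + \sum_(u | adj v u) (u \in O) <= B) ->
  (forall v, covered M v) -> th * wt w O <= 2 * B * util M.
Proof.
move=> OB cov; rewrite /wt big_mkcond big_distrr.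
apply: (@leq_trans (\sum_v (v \in O) * (2 * (w v * M v + \sum_(u | adj v u) w u * M u)))).
  apply: leq_sum => v _ /=; case: ifP => _; last by rewrite muln0.
  by rewrite mul1n mulnC; exact: cov.
apply: (@leq_trans (\sum_v 2 * (((v \in O) + \sum_(u | adj v u) (u \in O)) * (w v * M v)))).
  rewrite leq_eqVlt; apply/orP; left; apply/eqP.
  under eq_bigr do rewrite mulnCA mulnDr.
  under [RHS]eq_bigr do rewrite mulnDl.
  rewrite -!big_distrr !big_split /=; congr (_ * (_ + _)).
  under eq_bigr do rewrite big_distrr.
  rewrite big_adjC; apply: eq_bigr => v _; rewrite big_distrl.
  by [].
rewrite -big_distrr -mulnA leq_mul2l /= /util big_distrr; apply: leq_sum => v _ /=.
by rewrite leq_mul2r OB orbT.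
Qed.
End GreedyFrac.

(** * Boosting by local ratio *)

(* The remaining weight rem of a node is private; its neighbors only know an
   estimate wt with rem <= 2 * wt.  A node whose estimate exceeds rem sits out one
   iteration and halves the estimate, so one bit per iteration suffices.  The
   reductions made by S use the estimates, and S joins the final set, after the
   recursive call, wherever it is not blocked. *)
Fixpoint boost (isf : nat * seq nat -> prog (bool * seq bool)) (n rem : nat)
    (wt : nat * seq nat) : prog (bool * seq bool) :=
  if n is n'.+1 then
    bind (step (fun x => [:: x.1 <= rem]) (fun x m => (x, head false m)) wt) (fun act =>
    let aw := mapk (fun x : nat * bool => if x.2 then x.1 else 0) act in
    bind (isf aw) (fun S =>
    let push := mapk (fun x : bool * nat => x.1 * x.2) (pairk S aw) in
    bind (boost isf n' (rem - (push.1 + \sum_(x <- push.2) x))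
            (mapk (fun x : nat * bool => if x.2 then x.1 else x.1./2) act)) (fun I =>
    step (fun x => [:: x.1 || (S.1 && ~~ has id x.2)]) (fun _ => head false) I)))
  else Ret (mapk (fun _ => false) wt).

Section Boost.
Variables (R : realFieldType) (c : nat) (N : network c) (F : pred {set N}) (K : nat).

(** Two families matter: the independent sets, where this is OPT and [K] is the maximum of 1 and
    beta, and the full set alone, where this is w(V) and [K] is Delta + 1. *)
Definition fam_opt (w : N -> nat) : nat := \max_(O : {set N} | F O) wt w O.

Hypothesis FK : forall O, F O -> forall v, (v \in O) + \sum_(u | adj v u) (u \in O) <= K.

Lemma fam_opt_leq w m : (forall O, F O -> wt w O <= m) -> fam_opt w <= m.
Proof. by move=> le; apply/bigmax_leqP. Qed.

Lemma leq_fam_opt w O : F O -> wt w O <= fam_opt w.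
Proof. by move=> FO; exact: (@leq_bigmax_cond _ F (wt w)). Qed.

Lemma fam_opt_mono f g : (forall v, f v <= g v) -> fam_opt f <= fam_opt g.
Proof.
move=> le; apply: fam_opt_leq => O FO; apply: leq_trans (leq_fam_opt g FO).
exact: leq_sum.
Qed.

Lemma fam_optD f g : fam_opt (fun v => f v + g v) <= fam_opt f + fam_opt g.
Proof.
by apply: fam_opt_leq => O FO; rewrite /wt big_split leq_add ?leq_fam_opt.
Qed.

Lemma fam_opt_half f : 2 * fam_opt (fun v => (f v)./2) <= fam_opt f.
Proof.
suff : fam_opt (fun v => (f v)./2) <= (fam_opt f)./2 by lia.
apply: fam_opt_leq => O FO; have := leq_fam_opt f FO.
suff : 2 * wt (fun v => (f v)./2) O <= wt f O by lia.
by rewrite /wt big_distrr; apply: leq_sum => v _ /=; lia.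
Qed.

(** A reduction made by a member of [S] hits its closed neighborhood, of which a set of the family
    contains at most [K] nodes. *)
Lemma fam_opt_reduce f f' g (S : N -> bool) :
  (forall v, f v <= f' v + (S v * g v + \sum_(u | adj v u) S u * g u)) ->
  fam_opt f <= fam_opt f' + K * \sum_v S v * g v.
Proof.
move=> le; apply: leq_trans (fam_opt_mono le) (leq_trans (fam_optD _ _) _).
rewrite leq_add2l; apply: fam_opt_leq => O FO; rewrite /wt big_mkcond.
apply: (@leq_trans (\sum_v ((v \in O) * (S v * g v) + \sum_(u | adj v u) (v \in O) * (S u * g u)))).
  apply: leq_sum => v _ /=; rewrite -big_distrr -mulnDr.
  by case: (v \in O); rewrite ?mul1n.
rewrite big_split big_adjC -big_split big_distrr; apply: leq_sum => v _ /=.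
by rewrite -big_distrl -mulnDl leq_mul2r FK ?orbT.
Qed.

Variables (B r : nat) (isf : N -> nat * seq nat -> prog (bool * seq bool)) (w0 : N -> nat).
Hypothesis B0 : 0 < B.
Hypothesis isfP : forall w, (forall v, w v <= w0 v) ->
  exists2 S, exec B (fun v => isf v (view w v)) r (view S) &
    [/\ indep S, forall v, S v -> 0 < w v &
        fam_opt w <= 32 * K * \sum_(v | S v) w v].

(* The standard local-ratio argument: a vertex v of I pays for all reductions
   made on N[v]. *)
Lemma local_ratio (rem rem' g : N -> nat) (S I' I : N -> bool) :
  (forall v, rem' v = rem v - (S v * g v + \sum_(u | adj v u) S u * g u)) ->
  (forall v, S v -> g v <= rem v) -> (forall v, I' v -> 0 < rem' v) ->
  (forall v, I v = I' v || (S v && ~~ [exists u, adj v u && I' u])) ->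
  \sum_(v | I' v) rem' v + \sum_v S v * g v <= \sum_(v | I v) rem v.
Proof.
move=> rem'E Sg I'pos IE.
pose push v := S v * g v + \sum_(u | adj v u) S u * g u.
have -> : \sum_(v | I v) rem v =
    \sum_(v | I' v) rem' v + \sum_v (I' v * push v + (I v && ~~ I' v) * rem v).
  rewrite big_mkcond [in RHS]big_mkcond -big_split; apply: eq_bigr => v _ /=.
  rewrite IE; case I'v: (I' v) => /=; last by case: (_ && _) => /=; lia.
  (* A positive [rem'] means that the truncated subtraction was exact. *)
  by have := I'pos v I'v; rewrite rem'E -/(push v); lia.
rewrite leq_add2l big_split /= /push.
under [X in _ <= X + _]eq_bigr do rewrite mulnDr big_distrr.
rewrite big_split big_adjC -!big_split; apply: leq_sum => v _ /=.
case Sv: (S v) => //; rewrite mul1n IE Sv.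
case I'v: (I' v) => /=; first by rewrite !mul1n; lia.
case: existsP => [[u /andP[vu I'u]]|_] /=; last by rewrite mul1n; have := Sg v Sv; lia.
by rewrite (bigD1 u) //= I'u !mul1n; lia.
Qed.

Local Notation decay := ((255%:R / 256%:R)%R : R).

(* D stands for the optimum of the remaining weights, P and a for the optimum of the
   estimates of the inactive and of the active nodes: D + P / 64 is a potential that
   either shrinks geometrically or is paid for by the gain s. *)
Lemma decay_step (n : nat) (D D' P P' a s x : R) :
  (0 <= a)%R -> (0 <= P)%R -> (a <= 32%:R * s)%R -> (D <= D' + s)%R ->
  (D <= 2%:R * a + P)%R -> (P' <= a + P / 2%:R)%R ->
  (D' - decay ^+ n * (D' + P' / 64%:R) <= x)%R ->
  (D - decay ^+ n.+1 * (D + P / 64%:R) <= s + x)%R.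
Proof.
move=> a0 P0 as_ DD' Da P'a.
have t0 : (0 <= decay ^+ n)%R by rewrite exprn_ge0 // divr_ge0.
have t1 : (decay ^+ n <= 1)%R by rewrite exprn_ile1 ?divr_ge0 // ler_pdivrMr // mul1r ler_nat.
rewrite exprS; move: (decay ^+ n)%R t0 t1 => t t0 t1 Hx.
(* Taking [H1] to [H4] with coefficients 1, 1/64, 1/256 and 1/32 leaves a slack of t * a / 128 + 63
   * t * P / 16384. *)
have H1 : (0 <= (1 - t) * (D' + s - D))%R by apply: mulr_ge0; lra.
have H2 : (0 <= t * (a + P / 2%:R - P'))%R by apply: mulr_ge0; lra.
have H3 : (0 <= t * (2%:R * a + P - D))%R by apply: mulr_ge0; lra.
have H4 : (0 <= t * (32%:R * s - a))%R by apply: mulr_ge0; lra.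
have H5 : (0 <= t * a)%R by apply: mulr_ge0.
have H6 : (0 <= t * P)%R by apply: mulr_ge0.
lra.
Qed.

Lemma exec_boost n (rem wt : N -> nat) :
  (forall v, rem v <= 2 * wt v) -> (forall v, wt v <= w0 v) ->
  exists2 I, exec B (fun v => boost (isf v) n (rem v) (view wt v)) (n * r.+2) (view I) &
    [/\ indep I, forall v, I v -> 0 < rem v &
      ((fam_opt rem)%:R - decay ^+ n * ((fam_opt rem)%:R +
        (fam_opt (fun v => if (wt v <= rem v)%N then 0 else wt v))%:R / 64%:R)
       <= (K * \sum_(v | I v) rem v)%:R :> R)%R].
Proof.
elim: n rem wt => [|n IH] rem wt rem2 wtw.
  exists (fun _ => false); last split=> //.
    by apply: exec_ret => v; rewrite /= mapk_view.
  by rewrite big_pred0 // muln0 expr0 mul1r opprD addNKr oppr_le0 divr_ge0.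
pose act v := wt v <= rem v.
pose aw v := if act v then wt v else 0.
have [|S eS [Sind Spos Sopt]] := isfP (w := aw).
  by move=> v; rewrite /aw; case: ifP.
pose g v := S v * aw v.
pose rem' v := rem v - (g v + \sum_(u | adj v u) g u).
pose wt' v := if act v then wt v else (wt v)./2.
have [||I' eI' [I'ind I'pos I'opt]] := IH rem' wt'.
(* An inactive node has [rem < wt], so [rem] is at most twice the halved estimate even if [wt] is
   odd. *)
- by move=> v; have := rem2 v; rewrite /rem' /wt' /act; case: (leqP (wt v)); lia.
- by move=> v; have := wtw v; rewrite /wt'; case: ifP => _; lia.
pose I v := I' v || (S v && ~~ has id (view I' v).2).
have IE v : I v = I' v || (S v && ~~ [exists u, adj v u && I' u]).
  congr (_ || (_ && ~~ _)); apply/has_view/existsP => -[u].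
    by move=> vu I'u; exists u; rewrite vu.
  by case/andP=> vu I'u; exists u.
have SI v : S v -> aw v <= rem v.
  by rewrite /aw /act; case: (leqP (wt v)).
have I_rem v : I v -> 0 < rem v.
  case/orP=> [/I'pos|/andP[Sv _]]; first by rewrite /rem'; lia.
  exact: leq_trans (Spos v Sv) (SI v Sv).
have Sw : \sum_(v | S v) aw v = \sum_v g v.
  by rewrite big_mkcond; apply: eq_bigr => v _; rewrite /g; case: (S v); rewrite ?mul1n.
have Iw : \sum_(v | I' v) rem' v + \sum_v g v <= \sum_(v | I v) rem v.
  exact: (local_ratio (g := aw) (S := S)).
have nbrI u v : adj u v -> I' u -> ~~ (S v && ~~ [exists x, adj v x && I' x]).
  move=> uv I'u; rewrite negb_and negbK; apply/orP; right.
  by apply/existsP; exists u; rewrite adj_sym uv.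
exists I; last split=> //.
- pose A v := (wt v, act v).
  have e1 : exec B (fun v => step (fun x => [:: x.1 <= rem v])
      (fun x m => (x, head false m)) (view wt v)) 1 (view A).
    by apply: (@exec_step _ _ _ _ _ (fun v _ => _) (fun x m => _)).
  rewrite (_ : n.+1 * r.+2 = 1 + (r + (n * r.+2 + 1))); last by rewrite mulSn; lia.
  apply: (exec_bind (Q := fun v act => _) e1).
  set P := fun v => bind (isf v _) _.
  have -> : P = fun v => bind (isf v (view aw v)) (fun S =>
    let push := mapk (fun x : bool * nat => x.1 * x.2) (pairk S (view aw v)) in
    bind (boost (isf v) n (rem v - (push.1 + \sum_(x <- push.2) x)) (view wt' v)) (fun I =>
    step (fun x => [:: x.1 || (S.1 && ~~ has id x.2)]) (fun _ => head false) I)).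
    by apply: functional_extensionality => v; rewrite /P !mapk_view.
  apply: (exec_bind (Q := fun v S => _) eS).
  set P' := fun v => bind _ _.
  have -> : P' = fun v => bind (boost (isf v) n (rem' v) (view wt' v)) (fun I =>
    step (fun x => [:: x.1 || (S v && ~~ has id x.2)]) (fun _ => head false) I).
    by apply: functional_extensionality => v; rewrite /P' pairk_view mapk_view (big_view _ (fun x => x)).
  apply: (exec_bind (Q := fun v I => _) eI').
  by apply: (@exec_step _ _ _ _ _ (fun v _ => _) (fun _ => _)).
- move=> u v uv; rewrite !IE => /orP[I'u|/andP[Su nu]]; rewrite negb_or.
    by rewrite (I'ind u v uv I'u) (nbrI u v).
  rewrite negb_and (Sind u v uv Su) /= andbT; apply: contra nu => I'v.
  by apply/existsP; exists v; rewrite uv.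
apply: le_trans (_ : (K * (\sum_v g v + \sum_(v | I' v) rem' v))%:R <= _)%R; last first.
  by rewrite ler_nat leq_mul2l addnC Iw orbT.
rewrite mulnDr natrD; apply: (decay_step (a := (fam_opt aw)%:R)) I'opt; rewrite ?ler0n //.
- by rewrite -natrM ler_nat mulnA -Sw.
- rewrite -natrD ler_nat; apply: (fam_opt_reduce (g := aw) (S := S)) => v.
  by rewrite /rem' /g; lia.
- rewrite -natrM -natrD ler_nat.
  apply: leq_trans (_ : fam_opt (fun v => aw v + (aw v + if act v then 0 else wt v)) <= _).
    by apply: fam_opt_mono => v; have := rem2 v; rewrite /aw /act; case: (leqP (wt v)); lia.
  by rewrite mul2n -addnn -addnA (leq_trans (fam_optD _ _)) // leq_add2l fam_optD.
rewrite -(ler_pM2l (x := 2%:R)) ?ltr0n // mulrDr mulrCA divff ?mulr1 ?pnatr_eq0 //.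
rewrite -!natrM -natrD ler_nat.
apply: leq_trans (_ : 2 * (fam_opt aw + fam_opt (fun v => (if act v then 0 else wt v)./2)) <= _).
  rewrite leq_mul2l /=; apply: leq_trans (fam_optD _ _); apply: fam_opt_mono => v.
  by rewrite /wt' /aw; case: (act v); case: ifP => _; lia.
by rewrite mulnDr leq_add2l fam_opt_half.
Qed.

End Boost.

(** * The initial coloring of the network *)

Lemma leq_expl e m n : m <= n -> m ^ e <= n ^ e.
Proof. by case: e => // e; rewrite leq_exp2r. Qed.

Definition weights (li : local_input) : nat * seq nat :=
  (in_weight li, in_nbr_weights li).

(* Identifiers replace the given colors when these are too long for a message. *)
Definition coloring (c : nat) (gl : global_input) (li : local_input) :
    prog (nat * seq nat) :=
  let small := gl_colors gl <= gl_n gl ^ c in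
  linial (gl_degree gl) (up_log 2 (if small then gl_colors gl else gl_n gl ^ c))
    (log_star (gl_colors gl)) (weights li) (if small then in_color li else in_ident li).

Definition color_bits (D : nat) : nat := (up_log 2 D).*2.*2 + 68.

Section Coloring.
Variables (c : nat) (N : network c).
Let D := max_degree N.
Let B := 64 * c.+1 * up_log 2 #|N|.

Lemma weightsE v : weights (net_input v) = view (@weight c N) v.
Proof. by []. Qed.

Lemma deg_lt_card : 0 < D -> D < #|N|.
Proof.
move=> D0; have N0 : 0 < #|N|.
  rewrite lt0n; apply/eqP=> /card0_eq N0; move: D0; rewrite /D /max_degree big1 // => v _.
  by have := N0 v.
have [v DE] := bigop.eq_bigmax (fun v : N => #|nbrs v|) N0.
rewrite /D /max_degree DE; apply: proper_card; apply/properP; split; first exact/subsetP.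
by exists v; rewrite ?inE // adj_irrefl.
Qed.

(** An edge forces n >= 2, so one-bit messages are allowed; edgeless graphs are handled without
    communication. *)
Lemma B_gt0 : 0 < D -> 0 < B.
Proof.
by move=> D0; rewrite /B !muln_gt0 up_log_gt0 /= (leq_trans _ (deg_lt_card D0)).
Qed.

Lemma exec_coloring : 0 < D ->
  exists2 col, exec B (fun v : N => coloring c (net_global_input N) (net_input v))
      (log_star (ncolors N)).+1 (view col) &
    proper col /\ forall v, col v < 2 ^ color_bits D.
Proof.
move=> D0; have DN := deg_lt_card D0; have N1 : 1 < #|N| by lia.
rewrite /coloring /=; set m := if _ then ncolors N else _.
set y := fun v : N => if ncolors N <= #|N| ^ c then (color v : nat) else ident v.
have mc : up_log 2 m <= c * up_log 2 #|N|.
  rewrite up_log_leE; apply: (@leq_trans (#|N| ^ c)); first by rewrite /m; case: ifP.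
  by rewrite mulnC expnM; rewrite leq_expl ?up_logK.
(* If identifiers are used, n ^ c is below the number of colors, so [log_star (ncolors N)] steps
   suffice for them too. *)
have mx : up_log 2 m <= up_log 2 (ncolors N).
  rewrite up_log_leE; apply: leq_trans (up_logK _).
  by rewrite /m; case: (leqP (ncolors N)) => // /ltnW.
have [|||col ecol [colp colb]] := @exec_linial c N B (up_log 2 m) (log_star (ncolors N))
  (@weight c N) y.
- by move=> i _; apply: iter_linial_bits_log => //; exact: ltnW.
- move=> u v uv; rewrite /y; case: ifP => _; first exact: color_proper.
  by apply/eqP=> /val_inj /ident_inj uv_eq; rewrite uv_eq adj_irrefl in uv.
- move=> v; rewrite /y /m; case: ifP => _; exact: leq_trans (ltn_ord _) (up_logK _).
exists col; first by [].
split=> // v; apply: leq_trans (colb v) _; rewrite leq_pexp2l //.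
exact: iter_linial_bits_log_star.
Qed.

End Coloring.

(** * Constant-factor independent sets and their boosting *)

Definition field_exp (J : nat) : nat := (up_log 2 (32 * J)).-1.

Lemma field_expP J : 0 < J -> 32 * J <= 2 ^ (field_exp J).+1 <= 64 * J.
Proof.
move=> J0; rewrite prednK ?up_log_gt0 /=; last by lia.
rewrite up_logK /=; have := up_log_gtn (isT : 1 < 2) (_ : 1 < 32 * J).
rewrite -{2}[up_log 2 _]prednK ?up_log_gt0 /= ?expnS; last by lia.
by move/(_ ltac:(lia)); lia.
Qed.

Lemma round_time_leq J k : 0 < J -> round_time (field_exp J) k <= 384 * k * J.
Proof.
move=> /field_expP /andP[_]; rewrite /round_time.
have := ltn_expl (field_exp J).+1 (isT : 1 < 2).
move: (field_exp J).+1 => a; move: (2 ^ a) => q aq qJ.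
by rewrite mulnAC mulnC leq_mul2r; apply/orP; right; lia.
Qed.

(** The 3 extra bits make 2 ^ (k - 3) at least [D], as the greedy growth requires. *)
Definition frac_bits (D : nat) : nat := up_log 2 D + 3.

Definition pick_is (R : realFieldType) (D : nat) (col : nat * seq nat)
    (frac : nat * seq nat -> prog (nat * seq nat)) (w : nat * seq nat) :
    prog (bool * seq bool) :=
  let k := frac_bits D in
  bind (frac w) (round_is (field_exp (2 * k)) (color_bits D) k (1 : R) w col).

(** Degrees 0 and 1 are treated apart because log D vanishes in the round bound of part (2): degree
    0 may have no round at all, degree 1 only time for the coloring. *)
Definition mwis (R : realFieldType) (c n : nat)
    (frac : global_input -> nat * seq nat -> prog (nat * seq nat))
    (gl : global_input) (li : local_input) : prog bool :=
  let w := weights li in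
  let D := gl_degree gl in
  if D == 0 then Ret true else
  bind (coloring c gl li) (fun col =>
  if D == 1 then
    let x := pairk w col in Ret (~~ has (beats x.1) x.2)
  else
    bind (boost (pick_is R D col (frac gl)) n w.1 w) (fun I => Ret I.1)).

Lemma energy_nat (R : realFieldType) (c : nat) (N : network c) (w M : N -> nat) (e h : R) :
  (energy w e h (fun v => (M v)%:R) =
   h * (util w M)%:R - (1 + e) / 2%:R * h ^+ 2 * (quad w M)%:R)%R.
Proof.
rewrite /energy /util /quad !natr_sum; congr (_ * _ - _ * _)%R.
  by apply: eq_bigr => v _; rewrite natrM.
apply: eq_bigr => v _; rewrite natr_sum; apply: eq_bigr => u _.
by rewrite !natrM.
Qed.

Section Mwis.
Variables (R : realFieldType) (c : nat) (N : network c) (F : pred {set N}) (K : nat).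
Hypothesis K0 : 0 < K.
Hypothesis FK : forall O, F O -> forall v, (v \in O) + \sum_(u | adj v u) (u \in O) <= K.
Let D := max_degree N.
Let w : N -> nat := @weight c N.
Let B := 64 * c.+1 * up_log 2 #|N|.
Let k := frac_bits D.
Variables (frac : global_input -> nat * seq nat -> prog (nat * seq nat)) (rf : nat).
Hypothesis fracP : 1 < D -> forall f, (forall v, f v <= w v) ->
  exists2 M, exec B (fun v => frac (net_global_input N) (view f v)) rf (view M) &
    [/\ forall v, M v <= 2 ^ k, quad f M <= 2 ^ k.-1 * util f M &
        2 ^ k * fam_opt F f <= 16 * K * util f M].

(** By Bernoulli, (256/255) ^ 256 >= 1 + 256/255 >= 2, so 256 iterations halve the deficit. *)
Lemma expr_decay m : ((255%:R / 256%:R) ^+ (256 * m) <= 2^-1 ^+ m :> R)%R.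
Proof.
rewrite exprM; apply: lerXn2r; rewrite ?nnegrE ?invr_ge0 ?exprn_ge0 ?divr_ge0 //.
have bern (x : R) n : (0 <= x -> 1 + n%:R * x <= (1 + x) ^+ n)%R.
  move=> x0; elim: n => [|n IH]; first by rewrite mul0r addr0.
  rewrite exprS -natr1; apply: le_trans (ler_wpM2l _ IH); last by rewrite addr_ge0.
  have : (0 <= n%:R * x * x)%R by rewrite !mulr_ge0.
  by lra.
have p0 : (0 < 255%:R :> R)%R by rewrite ltr0n.
have := bern (255%:R^-1)%R 256; rewrite invr_ge0 ltW // => /(_ isT).
have -> : (1 + 255%:R^-1 = (255%:R / 256%:R)^-1 :> R)%R by field.
rewrite exprVn => H; rewrite -[leLHS]invrK lef_pV2 ?posrE ?invr_gt0 ?exprn_gt0 ?divr_gt0 ?ltr0n //.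
by apply: le_trans H; rewrite -[2%R]/(1 + 1)%R lerD2l ler_pdivlMr // mul1r ler_nat.
Qed.

(** Every component is a node or an edge. A node outside [I] has a single neighbor, which is in [I]
    and not lighter, so one reduction by [I] clears all weights. *)
Lemma deg1_weight (col : N -> nat) : D = 1 -> proper col ->
  let I v := ~~ has (beats (w v, col v)) (view (fun u => (w u, col u)) v).2 in
  indep I /\ fam_opt F w <= K * \sum_(v | I v) w v.
Proof.
move=> D1 colp I; split.
  move=> u v uv nu; rewrite negbK; apply/has_view; exists u; first by rewrite adj_sym.
  rewrite (beatsC w colp) 1?adj_sym //; apply: contra nu => b.
  by apply/has_view; exists v.
have uniq_nbr (v u u' : N) : adj v u -> adj v u' -> u = u'.
  move=> vu vu'; have := leq_trans (deg_leq_max v) (eq_leq D1); rewrite (bigD1 u) //=.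
  by have [//|neq] := eqVneq u u'; rewrite (bigD1 u') //= vu' eq_sym.
have := @fam_opt_reduce _ _ F K FK w (fun _ => 0) w I.
have -> : fam_opt F (fun _ : N => 0) = 0.
  by apply/eqP; rewrite -leqn0; apply: fam_opt_leq => O _; rewrite /wt big1.
have -> : \sum_v I v * w v = \sum_(v | I v) w v.
  by rewrite [RHS]big_mkcond; apply: eq_bigr => v _; rewrite mulnbl.
rewrite add0n; apply=> v; rewrite add0n; case Iv: (I v); first by rewrite mul1n leq_addr.
have /has_view[u vu b] := negbFE Iv.
have Iu : I u.
  apply/negP=> /has_view[v' uv' b']; move: b'.
  rewrite -(uniq_nbr u v v' _ uv') 1?adj_sym // => b'.
  by move: b; rewrite (beatsC w colp vu) b'.
rewrite (bigD1 u) //= Iu mul1n mul0n add0n; apply: leq_trans (leq_addr _ _).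
by case/orP: b => /= [/ltnW //|/andP[/eqP-> _]].
Qed.

Lemma exec_pick_is (col : N -> nat) f : 1 < D ->
  proper col -> (forall v, col v < 2 ^ color_bits D) -> (forall v, f v <= w v) ->
  exists2 S, exec B (fun v => pick_is R D (view col v) (frac (net_global_input N)) (view f v))
    (rf + (round_time (field_exp (2 * k)) k).+1) (view S) &
    [/\ indep S, forall v, S v -> 0 < f v &
        fam_opt F f <= 32 * K * \sum_(v | S v) f v].
Proof.
move=> D1 colp colb fw.
have B0 : 0 < B by apply: B_gt0; lia.
have [M eM [Mk MQ MU]] := fracP D1 fw.
have k3 : 0 < k by rewrite /k /frac_bits addn3.
have /andP[a32 a64] := @field_expP (2 * k) ltac:(lia).
have [|||S eS [Sind Spos Sen]] := @exec_round_is R c N f col M B (field_exp (2 * k))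
  (color_bits D) (2 * k) k 1%R B0 a32 _ colp colb _ k3 _ Mk.
(* From b <= 512 * J and q >= 32 * J follows 2 * J * b <= 1024 * J ^ 2 <= q ^ 2. *)
- have : color_bits D <= 512 * (2 * k) by rewrite /color_bits /k /frac_bits; lia.
  move: a32; move: (2 ^ _) => q; move: (color_bits _) (2 * k) => b J; nia.
- by rewrite ler01 lexx.
- by rewrite mulr1 -natrM.
exists S; first exact: exec_bind eM eS.
split=> //.
(* For e = 1, the bound on [quad] keeps the energy at least half of util / 2 ^ k; with the 16 of
   [fracP] this makes 32. *)
have : (util f M <= 2 ^ k.+1 * \sum_(v | S v) f v).
  rewrite -(ler_nat R) natrM expnS natrM natrX -ler_pdivrMl; last by rewrite mulr_gt0 ?exprn_gt0 ?ltr0n.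
  apply: le_trans Sen; rewrite energy_nat exprVn.
  have := MQ; rewrite -(ler_nat R) natrM natrX.
  have -> : (2%:R ^+ k.-1 = 2%:R ^+ k / 2%:R :> R)%R.
    by rewrite -{2}(prednK k3) exprS mulrC mulKf ?pnatr_eq0.
  have h0 : (0 < 2%:R ^+ k :> R)%R by rewrite exprn_gt0 ?ltr0n.
  move: (2%:R ^+ k)%R h0 => T T0 QU.
  have : (T^-1 ^+ 2 * (quad f M)%:R <= T^-1 ^+ 2 * (T / 2%:R * (util f M)%:R) :> R)%R.
    by rewrite ler_wpM2l // exprn_ge0 // invr_ge0 ltW.
  have -> : (T^-1 ^+ 2 * (T / 2%:R * (util f M)%:R) = T^-1 * (util f M)%:R / 2%:R :> R)%R.
    by field; rewrite gt_eqF.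
  have -> : ((2%:R * T)^-1 * (util f M)%:R = T^-1 * (util f M)%:R / 2%:R :> R)%R.
    by field; rewrite gt_eqF.
  have -> : ((1 + 1) / 2%:R = 1 :> R)%R by field.
  by lra.
move: MU; move: (\sum_(v | S v) _) (util f M) (fam_opt F f) => s U Ph MU Us.
rewrite -(leq_pmul2l (expn_gt0 2 k)) (leq_trans MU) //.
rewrite expnS in Us; nia.
Qed.

Lemma exec_mwis m :
  exists2 t, t <= (if D == 0 then 0 else (log_star (ncolors N)).+1 +
      (if D == 1 then 0 else 256 * m * (rf + 768 * k ^ 2 + 3))) &
  exists2 I, exec B (fun v : N => mwis R c (256 * m) frac (net_global_input N) (net_input v))
      t I &
    indep I /\
    ((1 - 2^-1 ^+ m) * (fam_opt F w)%:R <= (K * \sum_(v | I v) w v)%:R :> R)%R.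
Proof.
have m1 : (1 - 2^-1 ^+ m <= 1 :> R)%R by rewrite gerBl exprn_ge0 ?invr_ge0.
have trivial_bound (x y : nat) : x <= y -> ((1 - 2^-1 ^+ m) * x%:R <= y%:R :> R)%R.
  by move=> xy; rewrite (le_trans (ler_piMl _ m1)) ?ler_nat.
rewrite /mwis; change (gl_degree _) with D; have [D0|D0] := posnP D.
  exists 0 => //; exists (fun _ => true); first exact: exec_retE.
  split=> [u v uv|].
    by have := leq_trans (deg_leq_max u) (eq_leq D0); rewrite (bigD1 v).
  apply: trivial_bound; apply: fam_opt_leq => O _.
  apply: (@leq_trans (\sum_v w v)); last by rewrite leq_pmull.
  by rewrite /wt big_mkcond; apply: leq_sum => v _; case: ifP.
have [col ecol [colp colb]] := exec_coloring D0.
have [D1|D1] := eqVneq D 1.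
  have [Iind Iw] := deg1_weight D1 colp.
  exists ((log_star (ncolors N)).+1 + 0) => //.
  eexists; last by split; [exact: Iind|exact: trivial_bound].
  apply: (exec_bind (Q := fun v col => _) ecol).
  by apply: exec_ret => v; rewrite weightsE pairk_view.
have D2 : 1 < D by lia.
pose r := rf + (round_time (field_exp (2 * k)) k).+1.
have isfP f : (forall v, f v <= w v) -> exists2 S, exec B (fun v =>
    pick_is R D (view col v) (frac (net_global_input N)) (view f v)) r (view S) &
    [/\ indep S, forall v, S v -> 0 < f v & fam_opt F f <= 32 * K * \sum_(v | S v) f v].
  exact: exec_pick_is.
have [||I eI [Iind _ Iw]] := @exec_boost R c N F K FK B r
  (fun v => pick_is R D (view col v) (frac (net_global_input N))) w (B_gt0 D0) isfP (256 * m) w w.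
- by move=> v; lia.
- by [].
exists ((log_star (ncolors N)).+1 + (256 * m * r.+2 + 0)).
  rewrite leq_add2l addn0 leq_mul2l; apply/orP; right; rewrite /r.
  have J0 : 0 < 2 * k by rewrite /k /frac_bits; lia.
  by have := round_time_leq k J0; rewrite expnS expn1; lia.
exists I.
  apply: (exec_bind (Q := fun v col => _) ecol).
  by apply: (exec_bind (Q := fun v I => _) eI); exact: exec_retE.
split=> //; apply: le_trans Iw.
(* Initially the estimates are exact, so no node is inactive and the second part of the potential
   vanishes. *)
have -> : fam_opt F (fun v => if w v <= w v then 0 else w v) = 0.
  apply/eqP; rewrite -leqn0; apply: fam_opt_leq => O _.
  by rewrite /wt big1 // => v _; rewrite leqnn.
rewrite mul0r addr0 -{2}[((fam_opt F w)%:R)%R]mul1r -mulrBl ler_wpM2r //.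
by rewrite lerD2l lerN2 expr_decay.
Qed.

End Mwis.

(** * The two fractional starting points *)

Definition frac_is (gl : global_input) : nat * seq nat -> prog (nat * seq nat) :=
  greedy_frac (frac_bits (gl_degree gl)) (trunc_log 2 (gl_weight gl)).

(** The common value is 1 / 2 ^ k, where 2 ^ k lies between 8 D and 16 D for D > 1. *)
Definition frac_all (gl : global_input) (w : nat * seq nat) : prog (nat * seq nat) :=
  Ret (mapk (fun _ => 1) w).

Section Instances.
Variables (c : nat) (N : network c).
Let D := max_degree N.
Let w : N -> nat := @weight c N.
Let W := max_weight w.
Let B := 64 * c.+1 * up_log 2 #|N|.
Let k := frac_bits D.

Lemma leq_max_weight v : w v <= W.
Proof. exact: (@bigop.leq_bigmax N w). Qed.

(** A member of [O] has no neighbor in [O], which accounts for the 1; the neighbors in [O] of any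
    other node form an independent set inside its neighborhood. *)
Lemma independent_nbrs (O : {set N}) : independent O ->
  forall v, (v \in O) + \sum_(u | adj v u) (u \in O) <= maxn 1 (nbr_independence N).
Proof.
move=> Oind v; have Oadj x y : x \in O -> y \in O -> ~~ adj x y.
  by move=> xO yO; move/forall_inP: Oind => /(_ x xO) /forall_inP /(_ y yO).
have [vO|vO] := boolP (v \in O).
  rewrite big1 ?addn0 ?leq_maxl // => u vu.
  by apply/eqP; rewrite eqb0; apply: contraL vu => uO; exact: Oadj.
rewrite add0n leq_max; apply/orP; right.
have -> : \sum_(u | adj v u) (u \in O) = #|nbrs v :&: O|.
  rewrite -sum1_card big_mkcond [RHS]big_mkcond; apply: eq_bigr => u _.
  by rewrite !inE; case: (adj v u); case: (u \in O).
apply: leq_trans (@bigop.leq_bigmax N _ v).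
apply: (@bigop.leq_bigmax_cond {set N} _ (fun S => #|S|) (nbrs v :&: O)).
rewrite subsetIl; apply/forall_inP=> x; rewrite inE => /andP[_ xO].
by apply/forall_inP=> y; rewrite inE => /andP[_ yO]; exact: Oadj.
Qed.

Lemma frac_isP : 1 < D -> forall f, (forall v, f v <= w v) ->
  exists2 M, exec B (fun v => frac_is (net_global_input N) (view f v))
      ((trunc_log 2 W).+1 * (k - 2)) (view M) &
    [/\ forall v, M v <= 2 ^ k, quad f M <= 2 ^ k.-1 * util f M &
        2 ^ k * fam_opt (@independent N) f <=
          16 * maxn 1 (nbr_independence N) * util f M].
Proof.
move=> D1 f fw; have B0 : 0 < B by apply: B_gt0; exact: ltnW.
have k3 : 3 <= k by rewrite /k /frac_bits addn3.
have Dk : D <= 2 ^ (k - 3) by rewrite /k /frac_bits addnK up_logK.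
have [|M eM [M2 MQ Mc]] := exec_greedy_frac k3 Dk B0 (L := trunc_log 2 W) (w := f).
  by move=> v; apply: leq_trunc_log; exact: leq_trans (fw v) (leq_max_weight v).
exists M => //; split=> //.
have -> : 2 ^ k = 8 * 2 ^ (k - 3) by rewrite -(expnD 2 3) subnKC.
have : 2 ^ (k - 3) * fam_opt (@independent N) f <=
    2 * maxn 1 (nbr_independence N) * util f M.
  have [O Oind ->] : {O | independent O & fam_opt (@independent N) f = wt f O}.
    apply: bigop.eq_bigmax_cond; apply/card_gt0P; exists set0; rewrite unfold_in.
    by apply/forall_inP=> x; rewrite inE.
  exact: covered_weight (independent_nbrs Oind) Mc.
by lia.
Qed.

Lemma deg_setT (O : {set N}) : O == [set: N] ->
  forall v, (v \in O) + \sum_(u | adj v u) (u \in O) <= D.+1.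
Proof.
move=> /eqP -> v; rewrite in_setT ltnS.
under eq_bigr do rewrite in_setT.
exact: deg_leq_max.
Qed.

Lemma frac_allP : 1 < D -> forall f, (forall v, f v <= w v) ->
  exists2 M, exec B (fun v => frac_all (net_global_input N) (view f v)) 0 (view M) &
    [/\ forall v, M v <= 2 ^ k, quad f M <= 2 ^ k.-1 * util f M &
        2 ^ k * fam_opt (pred1 [set: N]) f <= 16 * D.+1 * util f M].
Proof.
move=> D1 f _; exists (fun _ => 1).
  by apply: exec_ret => v; rewrite /frac_all mapk_view.
have Dk : D <= 2 ^ up_log 2 D by rewrite up_logK.
have kD : 2 ^ k = 8 * 2 ^ up_log 2 D by rewrite /k /frac_bits addnC expnD.
split; first by move=> v; rewrite expn_gt0.
  rewrite /quad /util big_distrr; apply: leq_sum => v _ /=.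
  apply: (@leq_trans (\sum_(u | adj v u) f v * 1)).
    by apply: leq_sum => u _; rewrite !muln1 geq_minl.
  rewrite -big_distrr muln1 [leqRHS]mulnC leq_mul2l; apply/orP; right.
  apply: leq_trans (deg_leq_max v) (leq_trans Dk _).
  by rewrite leq_pexp2l // /k /frac_bits; lia.
apply: leq_mul; last first.
  apply: fam_opt_leq => O /eqP ->; rewrite /wt /util.
  by rewrite big_mkcond; apply: leq_sum => v _; rewrite in_setT muln1.
rewrite kD; have := up_log_gtn (isT : 1 < 2) D1.
have : 0 < up_log 2 D by rewrite up_log_gt0.
by case: (up_log 2 D) => // u _ /=; rewrite expnS; lia.
Qed.

End Instances.

(** * The weighted degree bound *)

Definition share (k : nat) (w : nat * seq nat) : nat :=
  (w.1 * 2 ^ k) %/ (w.1 + \sum_(x <- w.2) x).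

Section Share.
Local Open Scope ring_scope.
Variables (R : realFieldType) (c : nat) (N : network c) (w : N -> nat) (k : nat).
Let S v : R := (w v + \sum_(u | adj v u) w u)%N%:R.
Let y v : R := (w v)%:R / S v.
Let m v := share k (view w v).
Let x v : R := (m v)%:R / 2 ^+ k.
Let U := \sum_v (w v)%:R * y v.

(** Where the closed neighborhood has weight 0, so has [v], and the quotients below are 0 by
    convention. *)
Let S_cases v : S v = 0 /\ w v = 0%N \/ 0 < S v.
Proof.
rewrite /S; have [/eqP|S0] := posnP (w v + \sum_(u | adj v u) w u)%N; last first.
  by right; rewrite ltr0n.
by rewrite addn_eq0 => /andP[/eqP w0 /eqP s0]; left; rewrite w0 s0.
Qed.

Let T0 : 0 < 2 ^+ k :> R. Proof. by rewrite exprn_gt0. Qed.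

Lemma share_le v : (m v <= 2 ^ k)%N.
Proof.
rewrite /m /share big_view /=; set s := (w v + _)%N.
have [->|s0] := posnP s; first by rewrite divn0.
by rewrite -(leq_pmul2r s0) (leq_trans (leq_trunc_div _ _)) // mulnC leq_mul2l leq_addr orbT.
Qed.

Let x0 v : 0 <= x v. Proof. by rewrite divr_ge0 // ltW. Qed.

Let xy v : x v <= y v.
Proof.
rewrite /x /y; case: (S_cases v) => [[S0 w0]|S0].
  by rewrite /m /share /= w0 mul0n div0n mul0r mul0r.
rewrite ler_pdivrMr // mulrAC ler_pdivlMr // /S /m /share big_view /=.
by rewrite -natrX -!natrM ler_nat leq_trunc_div.
Qed.

Let yx v : y v <= x v + (2 ^+ k)^-1.
Proof.
rewrite /y; case: (S_cases v) => [[S0 _]|S0].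
  by rewrite S0 invr0 mulr0 addr_ge0 // invr_ge0 ltW.
rewrite /x -[X in _ + X]mul1r -mulrDl ler_pdivrMr // mulrAC ler_pdivlMr //.
rewrite /S natr1 -natrX -!natrM ler_nat /m /share big_view /=.
by apply/ltnW/ltn_ceil; rewrite -(ltr0n R).
Qed.

Let yS v : y v * S v = (w v)%:R.
Proof.
rewrite /y; case: (S_cases v) => [[-> ->]|S0]; first by rewrite mulr0.
by rewrite divfK // gt_eqF.
Qed.

Let y0 v : 0 <= y v. Proof. by rewrite divr_ge0. Qed.

(** For a = w(v) and b = w(u), min(a, b) y_v y_u is at most half of b y_v ^ 2 + a y_u ^ 2. Both
    halves have the same sum, and the weights around [v] sum to at most [S v], where S v * y v ^ 2 =
    w v * y v. *)
Lemma share_quad :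
  \sum_v \sum_(u | adj v u) (minn (w v) (w u))%:R * (x v * x u) <= U.
Proof.
pose Y := \sum_v \sum_(u | adj v u) (w u)%:R * y v ^+ 2.
have YU : Y <= U.
  apply: ler_sum => v _; rewrite -mulr_suml -(yS v) mulrAC -expr2 mulrC.
  rewrite ler_wpM2l ?exprn_ge0 // -natr_sum ler_nat leq_addl //.
apply: le_trans YU; apply: (@le_trans _ _ (\sum_v \sum_(u | adj v u)
    2^-1 * ((w u)%:R * y v ^+ 2 + (w v)%:R * y u ^+ 2))).
  apply: ler_sum => v _; apply: ler_sum => u _.
  have mv : (minn (w v) (w u))%:R <= (w v)%:R :> R by rewrite ler_nat geq_minl.
  have mu : (minn (w v) (w u))%:R <= (w u)%:R :> R by rewrite ler_nat geq_minr.
  move: (minn _ _)%:R (ler0n R (minn (w v) (w u))) mv mu => M M0 mv mu.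
  have := ler_wpM2l M0 (ler_pM (x0 v) (x0 u) (xy v) (xy u)).
  have := ler_wpM2r (exprn_ge0 2 (y0 v)) mu.
  have := ler_wpM2r (exprn_ge0 2 (y0 u)) mv.
  have := mulr_ge0 M0 (sqr_ge0 (y v - y u)).
  by move: (w v)%:R (w u)%:R (x v * x u) => a b xx; nra.
under eq_bigr do rewrite -mulr_sumr big_split.
rewrite -mulr_sumr big_split /= [X in _ + X]big_adjC -/Y.
by rewrite -mulr2n mulrnAr -mulrnAl -[2^-1 *+ 2]mulr_natr mulVf ?mul1r // pnatr_eq0.
Qed.

(* Tangent line of t |-> t ^ 2 / S at S / d. *)
Let tangent d v : 0 < d -> 2 * (w v)%:R - S v / d <= d * ((w v)%:R * y v).
Proof.
move=> d0; have S0 : 0 <= S v by [].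
rewrite -(yS v) -subr_ge0; move: (S v) (y v) S0 => s t s0.
have -> : d * (t * s * t) - (2 * (t * s) - s / d) = s * (d * t - 1) ^+ 2 / d.
  by field; rewrite gt_eqF.
apply: divr_ge0 (ltW d0); exact: mulr_ge0 s0 (sqr_ge0 _).
Qed.

(** The tangent bounds sum to 2 w(V) minus the sum of [S] over d, and every weight enters the sum of
    [S] at most d times. This lower bound on [U] serves to absorb the truncation to [k] bits. *)
Lemma share_util : (\sum_v w v)%N%:R <= (max_degree N).+1%:R * U.
Proof.
set d : R := (max_degree N).+1%:R.
have d0 : 0 < d by rewrite ltr0n.
have SS : \sum_v S v <= d * (\sum_v w v)%N%:R.
  rewrite /S -natr_sum -natrM ler_nat big_split /= mulSn leq_add2l.
  rewrite big_adjC big_distrr; apply: leq_sum => v _ /=.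
  have -> : (\sum_(u | adj v u) w v = w v * \sum_(u | adj v u) 1)%N.
    by rewrite big_distrr; apply: eq_bigr => u _; rewrite /= muln1.
  by rewrite mulnC leq_mul2r deg_leq_max orbT.
have : \sum_v (2 * (w v)%:R - S v / d) <= d * U.
  by rewrite /U mulr_sumr; apply: ler_sum => v _; exact: tangent.
rewrite sumrB -mulr_sumr -mulr_suml -natr_sum => H.
have := SS; rewrite mulrC -ler_pdivrMr // => H'.
have aux (a b t : R) : 2 * a - b <= t -> b <= a -> a <= t by move=> *; lra.
exact: aux H H'.
Qed.

(** Truncation costs at most e / 2 * U and the quadratic part (1 + e) / 2 * U, which leaves 1/2 -
    e. *)
Lemma share_energy (e : R) : 0 <= e -> 2 * (max_degree N).+1%:R <= 2 ^+ k * e ->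
  (2^-1 - e) * (\sum_v (w v)%:R ^+ 2 / (w v + wt w (nbrs v))%:R)
    <= energy w e (2^-1 ^+ k) (fun v => (m v)%:R).
Proof.
move=> e0 Te.
have -> : \sum_v (w v)%:R ^+ 2 / (w v + wt w (nbrs v))%:R = U.
  apply: eq_bigr => v _; rewrite /y /S mulrA -expr2; congr (_ / (_ + _)%:R).
  by apply: eq_bigl => u; rewrite inE.
have -> : energy w e (2^-1 ^+ k) (fun v => (m v)%:R) =
    \sum_v (w v)%:R * x v - (1 + e) / 2 *
    \sum_v \sum_(u | adj v u) (minn (w v) (w u))%:R * (x v * x u).
  rewrite /energy exprVn; congr (_ - _).
    by rewrite mulr_sumr; apply: eq_bigr => v _; rewrite /x; ring.
  rewrite -mulrA; congr (_ * _); rewrite mulr_sumr; apply: eq_bigr => v _.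
  by rewrite mulr_sumr; apply: eq_bigr => u _; rewrite /x; ring.
have U0 : 0 <= U by apply: sumr_ge0 => v _; rewrite mulr_ge0.
have Ux : U <= \sum_v (w v)%:R * x v + (\sum_v w v)%N%:R / 2 ^+ k.
  rewrite natr_sum mulr_suml -big_split; apply: ler_sum => v _ /=.
  by rewrite -mulrDr ler_wpM2l.
have wU : (\sum_v w v)%N%:R / 2 ^+ k <= e / 2 * U.
  rewrite ler_pdivrMr //; apply: le_trans share_util _.
  have := ler_wpM2r U0 Te; lra.
have e2 : 0 <= (1 + e) / 2 by lra.
have := ler_wpM2l e2 share_quad.
by move: (\sum_v \sum_(u | _) _) (\sum_v _ * x v) Ux => Q X Ux; lra.
Qed.

End Share.

Local Open Scope ring_scope.

(** * Round complexity *)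

Section Log2.
Variable R : realType.
Implicit Types x y : R.

Lemma ln2_gt0 : 0 < ln 2 :> R.
Proof. by rewrite ln_gt0 // ltr1n. Qed.

Lemma log2_leq x y : 0 < x -> x <= y -> log2 x <= log2 y.
Proof.
move=> x0 xy; rewrite /log2 ler_pM2r ?invr_gt0 ?ln2_gt0 // ler_ln ?posrE //.
exact: lt_le_trans xy.
Qed.

Lemma log2M x y : 0 < x -> 0 < y -> log2 (x * y) = log2 x + log2 y.
Proof. by move=> x0 y0; rewrite /log2 lnM ?posrE // mulrDl. Qed.

Lemma log2Xn n : log2 (2 ^+ n) = n%:R :> R.
Proof. by rewrite /log2 lnXn // -[ln 2 *+ n]mulr_natl mulfK // gt_eqF ?ln2_gt0. Qed.

Lemma log2_2 : log2 2 = 1 :> R.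
Proof. by rewrite /log2 divff // gt_eqF ?ln2_gt0. Qed.

Lemma trunc_log_log2 n : (0 < n)%N -> (trunc_log 2 n)%:R <= log2 n%:R :> R.
Proof.
move=> n0; rewrite -log2Xn log2_leq ?exprn_gt0 // -natrX ler_nat.
exact: trunc_logP.
Qed.

Lemma up_log_log2 n x : (0 < n)%N -> n%:R <= x -> (up_log 2 n)%:R <= log2 x + 1.
Proof.
move=> n0 nx; have n0R : 0 < n%:R :> R by rewrite ltr0n.
apply: le_trans (_ : log2 (n%:R : R) + 1 <= _); last by rewrite lerD2r log2_leq.
have [n1|n1] := leqP n 1.
  by rewrite (_ : up_log 2 n = 0%N) ?addr_ge0 ?divr_ge0 ?ln_ge0 ?ler1n //; case: n n1 {n0 nx n0R} => [|[]].
rewrite -lerBlDr; apply: le_trans (_ : (up_log 2 n).-1%:R <= _).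
  by rewrite lerBlDr natr1 ler_nat leqSpred.
rewrite -(log2Xn (up_log 2 n).-1) log2_leq ?exprn_gt0 // -natrX ler_nat.
by apply: ltnW; exact: up_log_gtn.
Qed.

End Log2.

Lemma log_star_gt0 x : (1 < x -> 0 < log_star x)%N.
Proof. by case: x => [|[|x]]. Qed.

(** With an edge there are two colors, so [log_star] is at least 1 and absorbs constant numbers of
    rounds. *)
Lemma ncolors_gt1 c (N : network c) : (0 < max_degree N -> 1 < ncolors N)%N.
Proof.
move=> D0; have /existsP[v /existsP[u uv]] : [exists v : N, [exists u : N, adj v u]].
  apply: contraTT D0 => /existsPn nadj.
  rewrite -leqNgt; apply/bigmax_leqP => v _.
  rewrite leqn0 cards_eq0; apply/eqP/setP => u; rewrite !inE.
  by apply/negP => vu; case/negP: (nadj v); apply/existsP; exists u.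
have := color_proper uv; rewrite -(inj_eq val_inj) /=.
by have := ltn_ord (color v); have := ltn_ord (color u); lia.
Qed.

(** Makes 2 ^ k exceed 2 (D + 1) / e for [share_energy], as [share_prec] makes J exceed 2 k / e for
    [exec_rounding]. *)
Definition share_bits (R : realType) (e : R) (D : nat) : nat :=
  up_log 2 (Num.truncn (2 * D.+1%:R / e)).+1.

Definition share_prec (R : realType) (e : R) (D : nat) : nat :=
  (Num.truncn (2 * (share_bits e D)%:R / e)).+1.

Definition share_is (R : realType) (e : R) (c : nat) (gl : global_input)
    (li : local_input) : prog bool :=
  let w := weights li in
  let D := gl_degree gl in
  let k := share_bits e D in
  if D == 0%N then Ret true else
  bind (coloring c gl li) (fun col =>
  bind (slow_share k.+1 (share k w) w) (fun M =>
  bind (round_is (field_exp (share_prec e D)) (color_bits D) k e w col M) (fun S =>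
  Ret S.1))).

Lemma exec_share_is (R : realType) (e : R) (c : nat) (N : network c) :
  0 < e <= 1 ->
  let D := max_degree N in let k := share_bits e D in
  exists2 t, (t <= if D == 0 then 0 else
      (log_star (ncolors N)).+1 + (384 * k * share_prec e D + k + 2))%N &
  exists2 I, exec (64 * c.+1 * up_log 2 #|N|)
      (fun v : N => share_is e c (net_global_input N) (net_input v)) t I &
    indep I /\
    (2^-1 - e) * (\sum_(v : N) (weight v)%:R ^+ 2
                   / (weight v + wt (@weight c N) (nbrs v))%:R)
      <= (\sum_(v | I v) weight v)%N%:R.
Proof.
move=> /andP[e0 e1] D k; pose w := @weight c N.
rewrite /share_is; change (gl_degree _) with D; have [D0|D0] := posnP D.
  exists 0%N => //; exists (fun _ => true); first exact: exec_retE.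
  split=> [u v uv|].
    by have := leq_trans (deg_leq_max u) (eq_leq D0); rewrite (bigD1 v).
  apply: (@le_trans _ _ (\sum_(v : N) (weight v)%:R)); last by rewrite natr_sum.
  apply: (@le_trans _ _ (\sum_(v : N) (weight v)%:R ^+ 2
                   / (weight v + wt (@weight c N) (nbrs v))%:R)).
    rewrite ler_piMl //; last by lra.
    by apply: sumr_ge0 => v _; rewrite divr_ge0 ?exprn_ge0.
  apply: ler_sum => v _; have [->|wv] := posnP (weight v).
    by rewrite expr0n /= mul0r.
  rewrite ler_pdivrMr ?ltr0n ?addn_gt0 ?wv // expr2 ler_wpM2l //.
  by rewrite ler_nat leq_addr.
have B0 := B_gt0 D0.
have [col ecol [colp colb]] := exec_coloring D0.
have k0 : (0 < k)%N.
  rewrite up_log_gt0 /= ltnS truncn_gt0 ler_pdivlMr // mul1r.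
  apply: le_trans e1 _; rewrite -natrM ler1n; lia.
have Tk : 2 * D.+1%:R <= 2 ^+ k * e.
  rewrite -ler_pdivrMr //; apply: (@le_trans _ _ (Num.truncn (2 * D.+1%:R / e)).+1%:R).
    by apply/ltW/truncnS_gt.
  by rewrite -natrX ler_nat up_logK.
set J := share_prec e D.
have Je : 2 * k%:R <= J%:R * e by rewrite -ler_pdivrMr //; apply/ltW/truncnS_gt.
have Jk : (2 * k <= J)%N.
  rewrite -(ler_nat R) natrM (le_trans Je) // ler_piMr //.
have Dk : (up_log 2 D <= k)%N.
  rewrite up_log_leE -(ler_nat R) natrX.
  apply: (@le_trans _ _ (2 ^+ k * e)); last by rewrite ler_piMr ?exprn_ge0.
  by apply: le_trans Tk; rewrite -natrM ler_nat; lia.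
pose m v := share k (view w v).
have [|||S eS [Sind _ Sw]] := @exec_round_is R c N w col m _ (field_exp J)
  (color_bits D) J k e B0 _ _ colp colb _ k0 Je (share_le w k).
- by case/andP: (@field_expP J ltac:(lia)).
- have /andP[a32 _] := @field_expP J ltac:(lia).
  have : (color_bits D <= 512 * J)%N by rewrite /color_bits; lia.
  by move: a32; move: (2 ^ _)%N => q; move: (color_bits _) => b; nia.
- by rewrite ltW.
exists ((log_star (ncolors N)).+1 +
  (k.+1 + ((round_time (field_exp J) k).+1 + 0)))%N.
  rewrite leq_add2l; have : (round_time (field_exp J) k <= 384 * k * J)%N.
    by apply: round_time_leq; lia.
  by lia.
exists S.
  apply: (exec_bind (Q := fun v col => _) ecol).
  apply: (exec_bind (Q := fun v M => _) (a := view m)).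
    apply: (exec_slow_share (@weight c N) B0) => v.
    by apply: leq_ltn_trans (share_le w k v) _; rewrite ltn_exp2l.
  by apply: (exec_bind (Q := fun v S => _) eS); exact: exec_retE.
split=> //; apply: le_trans Sw; apply: share_energy => //; exact: ltW.
Qed.

Lemma run_prog_computes (c : nat) (N : network c) K
    (p : global_input -> local_input -> prog bool) t (I : N -> bool) :
  exec (K * up_log 2 #|N|)
    (fun v : N => p (net_global_input N) (net_input v)) t I -> indep I ->
  [/\ congest (run_prog p) N K, computes (run_prog p) t [set v | I v],
      independent [set v | I v] &
      wt (@weight c N) [set v | I v] = (\sum_(v | I v) weight v)%N].
Proof.
move=> /exec_run [comp msg] Iind; split=> //.
- apply/forall_inP=> u; rewrite inE => Iu; apply/forall_inP=> v; rewrite inE => Iv.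
  by apply/negP=> uv; case/negP: (Iind u v uv Iu).
by apply: eq_bigl => v; rewrite inE.
Qed.

Definition iterations (R : realType) (e : R) : nat := up_log 2 (Num.truncn e^-1).+1.

Section Bounds.
Variables (R : realType) (e : R).
Hypothesis e0 : 0 < e.

Lemma log_inv_ge1 : 1 <= log_inv e.
Proof. by rewrite /log_inv le_max lexx. Qed.

Lemma iterations_leq : (iterations e)%:R <= 3 * log_inv e.
Proof.
have ei : 0 < e^-1 by rewrite invr_gt0.
have := log_inv_ge1; set l := log_inv e => l1.
apply: (@le_trans _ _ (log2 (2 * Num.max 1 e^-1) + 1)).
  apply: up_log_log2 => //; rewrite -natr1 mulr_natl mulr2n lerD //.
    have tr : (Num.truncn e^-1)%:R <= e^-1 by rewrite truncn_le ltW.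
    by rewrite (le_trans tr) // le_max lexx orbT.
  by rewrite le_max lexx.
rewrite log2M ?lt_max ?ltr01 // log2_2.
suff : log2 (Num.max 1 e^-1) <= l by lra.
have [e1|e1] := leP 1 e^-1; first by rewrite /l /log_inv le_max lexx orbT.
by apply: le_trans l1; rewrite /log2 ln1 mul0r.
Qed.

Lemma iterations_decay : 2^-1 ^+ iterations e <= e.
Proof.
rewrite exprVn invf_ple ?posrE ?exprn_gt0 //.
apply/ltW/(lt_le_trans (truncnS_gt _)).
by rewrite -natrX ler_nat up_logK.
Qed.

(** 256 m is at most 768 times [log_inv e], and an iteration costs at most 10 + 768 * 25 + 3 <= 100
    * 200 in units of y ^ 2. *)
Lemma mwis_time (C y : R) (D ls m rf k t : nat) :
  768 * (100 * 200) <= C ->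
  0 <= y -> m%:R <= 3 * log_inv e -> (0 < D -> 0 < ls)%N ->
  ((1 < D)%N -> [/\ 1 <= y, k%:R <= 5 * y & rf%:R <= 10 * y ^+ 2]) ->
  (t <= if D == 0 then 0 else ls.+1 +
     (if D == 1 then 0 else 256 * m * (rf + 768 * k ^ 2 + 3)))%N ->
  t%:R <= C * (y ^+ 2 * log_inv e + ls%:R).
Proof.
move=> Cle y0 me ls0 Dy; have := log_inv_ge1; move: (log_inv e) me => l me l1.
rewrite -(ler_nat R) => tle; apply: le_trans tle _.
have yl : 0 <= y ^+ 2 * l by rewrite mulr_ge0 ?exprn_ge0 //; lra.
have Cyl : 768 * (100 * 200) * (y ^+ 2 * l) <= C * (y ^+ 2 * l) by rewrite ler_wpM2r.
have yl0 : 0 <= C * (y ^+ 2 * l) by rewrite mulr_ge0 //; lra.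
rewrite mulrDr.
case: D ls0 Dy => [|D] ls0 Dy; first by rewrite addr_ge0 // mulr_ge0 //; lra.
have ls1 : 1 <= ls%:R :> R by rewrite ler1n ls0.
have Cls : 2 * ls%:R <= C * ls%:R by rewrite ler_wpM2r //; lra.
case: D ls0 Dy => [|D] ls0 Dy; first by rewrite addn0 -natr1; lra.
have [//|y1 ky rfy] := Dy; rewrite /= (natrD _ ls.+1) -natr1.
rewrite (natrM _ (256 * m)) (natrM _ 256) (natrD _ (rf + _)) (natrD _ rf).
rewrite (natrM _ 768) natrX.
have Y1 : 1 <= y ^+ 2 by rewrite exprn_ege1.
have k2 : k%:R ^+ 2 <= 25 * y ^+ 2.
  rewrite (_ : 25 * y ^+ 2 = (5 * y) ^+ 2); last by ring.
  by rewrite lerXn2r ?nnegrE // mulr_ge0.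
have k20 : 0 <= k%:R ^+ 2 :> R by rewrite exprn_ge0.
move: (k%:R ^+ 2) k2 k20 Y1 => k2 k2y k20 Y1.
have : m%:R * (rf%:R + 768 * k2 + 3) <= (3 * l) * (100 * 200 * y ^+ 2).
  by apply: ler_pM => //; [rewrite !addr_ge0 ?mulr_ge0|lra].
by lra.
Qed.

End Bounds.

Lemma log2_nat_ge0 (R : realType) n : 0 <= log2 (n%:R : R).
Proof.
rewrite /log2 divr_ge0 ?(ltW (ln2_gt0 R)) //.
by case: n => [|n]; [rewrite ln0|rewrite ln_ge0 // ler1n].
Qed.

Lemma frac_bits_log2 (R : realType) (D : nat) (y : R) :
  (1 < D)%N -> log2 D%:R <= y -> 1 <= y /\ (frac_bits D)%:R <= 5 * y.
Proof.
move=> D1 Dy; have y1 : 1 <= y.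
  by apply: le_trans Dy; rewrite -[leLHS]log2_2 log2_leq // ler_nat.
split=> //; have := up_log_log2 (ltnW D1) (lexx (D%:R : R)).
by rewrite /frac_bits natrD; lra.
Qed.

Lemma share_time (R : realType) (C e : R) (D ls t : nat) :
  768 * (100 * 200) <= C -> 0 < e <= 2^-1 -> (0 < D -> 0 < ls)%N ->
  (t <= if D == 0 then 0 else
     ls.+1 + (384 * share_bits e D * share_prec e D + share_bits e D + 2))%N ->
  t%:R <= C * (log2 (D%:R / e) ^+ 2 / e + ls%:R).
Proof.
move=> Cle /andP[e0 e2] ls0 tle.
have ei : 1 <= e^-1 by rewrite invf_ge1 //; lra.
set z := log2 _; have zz : 0 <= z ^+ 2 / e by rewrite divr_ge0 ?sqr_ge0 // ltW.
case: D ls0 tle @z zz => [|D'] ls0 tle z zz.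
  by move: tle; rewrite leqn0 => /eqP ->; rewrite mulr_ge0 ?addr_ge0 //; lra.
set D := D'.+1 in tle z zz *; set k := share_bits e D in tle.
set J := share_prec e D in tle.
have D1 : 1 <= D%:R :> R by rewrite ler1n.
have De : 2 <= D%:R / e.
  rewrite ler_pdivlMr //; apply: (@le_trans _ _ 1) => //; lra.
have z1 : 1 <= z by rewrite -[leLHS]log2_2 log2_leq.
(* k <= log2 (8 D / e) + 1 = z + 4, at most 5 z since e <= 1/2 makes z at least 1. *)
have k5 : k%:R <= 5 * z.
  have -> : 5 * z = z + 4 * z by ring.
  apply: le_trans (_ : log2 (2 ^+ 3 * (D%:R / e)) + 1 <= _).
    apply: up_log_log2 => //.
    have x0 : 0 <= 2 * D.+1%:R / e by rewrite divr_ge0 ?mulr_ge0 // ltW.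
    have := truncn_le (2 * D.+1%:R / e); rewrite x0 -natr1 => tr.
    have E : 2 * D.+1%:R / e <= 4 * (D%:R / e).
      rewrite mulrA ler_pM2r ?invr_gt0 // -natr1; lra.
    by move: De E tr; move: (D%:R / e) (2 * _ / e) => q q'; lra.
  by rewrite log2M ?exprn_gt0 ?divr_gt0 ?ltr0n // log2Xn -/z; lra.
have k1 : 1 <= k%:R :> R.
  rewrite ler1n up_log_gt0 /= ltnS truncn_gt0 ler_pdivlMr // mul1r.
  by rewrite -natr1; lra.
have ke : 1 <= k%:R / e. by rewrite ler_pdivlMr ?mul1r; lra.
have Jk : J%:R <= 3 * (k%:R / e).
  have x0 : 0 <= 2 * k%:R / e by rewrite divr_ge0 ?mulr_ge0 // ltW.
  have := truncn_le (2 * k%:R / e); rewrite x0 /J /share_prec -/k -natr1.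
  by rewrite -mulrA; lra.
have ls1 : 1 <= ls%:R :> R by rewrite ler1n ls0.
have zz1 : z <= z ^+ 2 / e.
  rewrite -[leLHS]mulr1 expr2 ler_pM //; [lra|].
  by rewrite ler_peMr //; lra.
have kJ : k%:R * J%:R <= 75 * (z ^+ 2 / e).
  apply: le_trans (_ : k%:R * (3 * (k%:R / e)) <= _); first by rewrite ler_wpM2l.
  have -> : k%:R * (3 * (k%:R / e)) = 3 * (k%:R * k%:R / e) by ring.
  have -> : 75 * (z ^+ 2 / e) = 3 * ((5 * z) * (5 * z) / e) by ring.
  by rewrite ler_pM2l // ler_pM2r ?invr_gt0 // ler_pM.
move: tle; rewrite -(ler_nat R) /= => tle; apply: le_trans tle _.
rewrite mulrDr (natrD _ ls.+1) -natr1 (natrD _ (_ + k)) (natrD _ _ k).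
rewrite (natrM _ (384 * k)) (natrM _ 384) -[384%:R * _ * _]mulrA.
have Cz : 768 * (100 * 200) * (z ^+ 2 / e) <= C * (z ^+ 2 / e) by rewrite ler_wpM2r.
have Cls : 2 * ls%:R <= C * ls%:R by rewrite ler_wpM2r //; lra.
move: (k%:R * J%:R) (z ^+ 2 / e) kJ zz zz1 Cz => kJ q kJq q0 zq Cq.
by lra.
Qed.

(** * The three algorithms *)

Definition greedy_is (R : realType) (e : R) (c : nat) (gl : global_input)
    (li : local_input) : prog bool :=
  if gl_weight gl == 0%N then Ret false
  else mwis R c (256 * iterations e) frac_is gl li.

Section MainParts.
Variables (R : realType) (c : nat) (N : network c) (C e : R).
Hypotheses (CC : 768 * (100 * 200) <= C) (e0 : 0 < e).
Let D := max_degree N.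
Let w : N -> nat := @weight c N.
Let ls := log_star (ncolors N).
Let K := (64 * c.+1)%N.

Let C0 : 0 <= C. Proof. by move: CC; lra. Qed.

Let ls0 : (0 < D -> 0 < ls)%N.
Proof. by move=> D0; apply/log_star_gt0/ncolors_gt1. Qed.

Lemma apx_ratio x y : (1 - 2^-1 ^+ iterations e) * x%:R <= y%:R :> R ->
  (1 - e) * x%:R <= y%:R.
Proof.
apply: le_trans; rewrite ler_wpM2r // lerD2l lerN2.
exact: iterations_decay.
Qed.

Lemma greedy_is_correct : congest (run_prog (greedy_is e c)) N K /\
  exists (t : nat) (I : {set N}),
    [/\ t%:R <= C * (log2 (D * max_weight w)%:R ^+ 2 * log_inv e + ls%:R),
        computes (run_prog (greedy_is e c)) t I, independent I &
        (1 - e) / (maxn 1 (nbr_independence N))%:R * (opt w)%:R <= (wt w I)%:R].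
Proof.
have K0 : (0 < maxn 1 (nbr_independence N))%N by rewrite leq_max.
(* If all weights are 0, [log2 0] is 0 and the bound leaves no time for the greedy growth; the empty
   set is then optimal. *)
have [W0|W0] := posnP (max_weight w).
  have ex : exec (K * up_log 2 #|N|)
      (fun v : N => greedy_is e c (net_global_input N) (net_input v)) 0 (fun _ => false).
    by apply: exec_ret => v; rewrite /greedy_is /= W0.
  have [//|cg cp Iind Iw] := run_prog_computes ex; split=> //.
  exists 0%N, [set v | false]; split=> //.
    apply: mulr_ge0 => //; rewrite addr_ge0 // mulr_ge0 ?sqr_ge0 //.
    exact: le_trans ler01 (log_inv_ge1 _).
  suff -> : opt w = 0%N by rewrite mulr0.
  apply/eqP; rewrite -leqn0; apply/bigmax_leqP => O _; rewrite /wt big1 // => v _.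
  by apply/eqP; rewrite -leqn0 -W0; exact: leq_max_weight.
have [t tle [I ex [Iind Iw]]] := @exec_mwis R c N _ _ K0 (@independent_nbrs c N)
  frac_is _ (@frac_isP c N) (iterations e).
have {}ex : exec (K * up_log 2 #|N|)
    (fun v : N => greedy_is e c (net_global_input N) (net_input v)) t I.
  suff -> : (fun v : N => greedy_is e c (net_global_input N) (net_input v)) =
    fun v : N => mwis R c (256 * iterations e) frac_is (net_global_input N) (net_input v).
    by [].
  by apply: functional_extensionality => v; rewrite /greedy_is /= gtn_eqF.
have [//|cg cp Iset wI] := run_prog_computes ex; split=> //.
exists t, [set v | I v]; split=> //; last first.
  rewrite mulrAC ler_pdivrMr ?ltr0n // wI -natrM mulnC.
  exact: apx_ratio.
apply: (mwis_time CC (log2_nat_ge0 _ _) (iterations_leq e0) ls0 _ tle) => D1.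
have DW : (0 < D * max_weight w)%N by rewrite muln_gt0 W0 (ltnW D1).
have DWD : log2 D%:R <= log2 (D * max_weight w)%:R :> R.
  by rewrite log2_leq ?ltr0n ?(ltnW D1) // ler_nat leq_pmulr.
have DWW : log2 (max_weight w)%:R <= log2 (D * max_weight w)%:R :> R.
  by rewrite log2_leq ?ltr0n // ler_nat leq_pmull // ltnW.
have [y1 ky] := frac_bits_log2 D1 DWD; split=> //.
have := le_trans (trunc_log_log2 R W0) DWW.
move: (log2 (D * max_weight w)%:R) y1 ky {DWD DWW} => y y1 ky Ly.
rewrite natrM (_ : 10 * y ^+ 2 = (2 * y) * (5 * y)); last by ring.
apply: ler_pM => //; first by rewrite -natr1; lra.
by apply: le_trans ky; rewrite ler_nat leq_subr.
Qed.

Lemma mwis_all_correct :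
  let p := mwis R c (256 * iterations e) frac_all in
  congest (run_prog p) N K /\
  exists (t : nat) (I : {set N}),
    [/\ t%:R <= C * (log2 D%:R ^+ 2 * log_inv e + ls%:R),
        computes (run_prog p) t I, independent I &
        (1 - e) * ((wt w [set: N])%:R / (D + 1)%:R) <= (wt w I)%:R].
Proof.
move=> p; have [t tle [I ex [Iind Iw]]] := @exec_mwis R c N (pred1 [set: N]) _
  (ltn0Sn D) (@deg_setT c N) frac_all _ (@frac_allP c N) (iterations e).
have [//|cg cp Iset wI] := run_prog_computes ex; split=> //.
exists t, [set v | I v]; split=> //; last first.
  rewrite mulrA ler_pdivrMr ?ltr0n ?addn1 // wI -natrM mulnC.
  apply: apx_ratio; apply: le_trans Iw.
  rewrite ler_wpM2l ?ler_nat //; last by apply: leq_fam_opt; rewrite /= eqxx.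
  by rewrite subr_ge0 exprn_ile1 ?invr_ge0 // invf_le1 // ler1n.
apply: (mwis_time CC (log2_nat_ge0 _ _) (iterations_leq e0) ls0 _ tle) => D1.
have [y1 ky] := frac_bits_log2 D1 (lexx (log2 (D%:R : R))); split=> //.
by rewrite mulr_ge0 ?sqr_ge0.
Qed.

Lemma share_is_correct :
  let p := if e < 2^-1 then share_is e c else fun _ _ => Ret false in
  congest (run_prog p) N K /\
  exists (t : nat) (I : {set N}),
    [/\ t%:R <= C * (log2 (D%:R / e) ^+ 2 / e + ls%:R),
        computes (run_prog p) t I, independent I &
        (2^-1 - e) * (\sum_(v : N) (weight v)%:R ^+ 2
                       / (weight v + wt w (nbrs v))%:R) <= (wt w I)%:R].
Proof.
(* For eps >= 1/2 the required weight is not positive, and the empty set does. *)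
move=> p; have [e2|e2] := ltP e 2^-1; last first.
  have ex : exec (K * up_log 2 #|N|)
      (fun v : N => p (net_global_input N) (net_input v)) 0 (fun _ => false).
    by apply: exec_ret => v; rewrite /p ltNge e2.
  have [//|cg cp Iind _] := run_prog_computes ex; split=> //.
  exists 0%N, [set v | false]; split=> //.
    by rewrite mulr_ge0 ?addr_ge0 ?divr_ge0 ?sqr_ge0 // ltW.
  apply: (@le_trans _ _ 0) => //; rewrite mulr_le0_ge0 ?subr_le0 //.
  by apply: sumr_ge0 => v _; rewrite divr_ge0 ?exprn_ge0.
have [|t tle [I ex [Iind Iw]]] := @exec_share_is R e c N; first by rewrite e0; lra.
have {}ex : exec (K * up_log 2 #|N|)
    (fun v : N => p (net_global_input N) (net_input v)) t I.
  suff -> : p = share_is e c by [].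
  by rewrite /p e2.
have [//|cg cp Iset wI] := run_prog_computes ex; split=> //.
exists t, [set v | I v]; split=> //; last by rewrite wI.
by apply: share_time tle => //; rewrite e0 ltW.
Qed.

End MainParts.

Theorem theorem1p3 (R : realType) (c : nat) :
  exists C K : nat, forall eps : R, 0 < eps ->
  [/\ exists A : algorithm, forall N : network c, congest A N K /\
        exists (t : nat) (I : {set N}),
        [/\ t%:R <= C%:R * (log2 (max_degree N * max_weight (@weight c N))%:R ^+ 2
                              * log_inv eps + (log_star (ncolors N))%:R),
            computes A t I,
            independent I &
            (1 - eps) / (maxn 1 (nbr_independence N))%:R
              * (opt (@weight c N))%:R
            <= (wt (@weight c N) I)%:R],
      exists A : algorithm, forall N : network c, congest A N K /\
        exists (t : nat) (I : {set N}),
        [/\ t%:R <= C%:R * (log2 (max_degree N)%:R ^+ 2 * log_inv eps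
                              + (log_star (ncolors N))%:R),
            computes A t I,
            independent I &
            (1 - eps) * ((wt (@weight c N) [set: N])%:R
                           / (max_degree N + 1)%:R)
            <= (wt (@weight c N) I)%:R] &
      exists A : algorithm, forall N : network c, congest A N K /\
        exists (t : nat) (I : {set N}),
        [/\ t%:R <= C%:R * (log2 ((max_degree N)%:R / eps) ^+ 2 / eps
                              + (log_star (ncolors N))%:R),
            computes A t I,
            independent I &
            (2^-1 - eps) * (\sum_(v : N) (weight v)%:R ^+ 2
                             / (weight v + wt (@weight c N) (nbrs v))%:R)
            <= (wt (@weight c N) I)%:R]].
Proof.
pose x : R := 768 * (100 * 200).
exists (Num.truncn x).+1, (64 * c.+1)%N => e e0.
have Cx : 768 * (100 * 200) <= (Num.truncn x).+1%:R :> R by apply/ltW/truncnS_gt.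
split.
- by exists (run_prog (greedy_is e c)) => N; exact: greedy_is_correct.
- exists (run_prog (mwis R c (256 * iterations e) frac_all)) => N.
  exact: mwis_all_correct.
exists (run_prog (if e < 2^-1 then share_is e c else fun _ _ => Ret false)) => N.
exact: share_is_correct.
Qed.
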